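(* Let $X$ be a complex infinite-dimensional Banach space, and let $\mathcal{I}$ be a non-zero, closed ideal of operators contained in the ideal $\mathcal{S}$ of strictly singular operators. Suppose that $Q\in\operatorname{IP}_\infty(\mathcal{F}(X))$ is of rank one. Then the map $\omega:\mathbb{Z}\to K_0(\mathcal{I}(X))$, $\nu\mapsto\nu\,[Q]_0$, is a group isomorphism.
   Context: All Banach spaces are complex and infinite-dimensional; $\mathcal{B}(X,Y)$ is the Banach space of continuous linear maps $X\to Y$ and $\mathcal{B}(X)=\mathcal{B}(X,X)$. $M_n(\mathcal{B}(X))$ is identified with $\mathcal{B}(X^n)$. An ideal of operators $\mathcal{I}$ assigns to each pair $(X,Y)$ of Banach spaces a subspace $\mathcal{I}(X,Y)$ of $\mathcal{B}(X,Y)$ such that $TSR\in\mathcal{I}(W,Z)$ whenever $R\in\mathcal{B}(W,X)$, $S\in\mathcal{I}(X,Y)$, $T\in\mathcal{B}(Y,Z)$; write $\mathcal{I}(X)=\mathcal{I}(X,X)$. It is closed if every $\mathcal{I}(X,Y)$ is norm-closed, non-zero if $\mathcal{I}(X,Y)\neq\{0\}$ for all $X,Y$ (equivalently, it contains the ideal $\mathcal{F}$ of finite-rank operators), and contained in $\mathcal{J}$ if $\mathcal{I}(X,Y)\subseteq\mathcal{J}(X,Y)$ for all $X,Y$. An operator $S:X\to Y$ is strictly singular ($S\in\mathcal{S}(X,Y)$) if every subspace of $X$ on which $S$ is bounded below is finite-dimensional. $\mathcal{I}(X)^\sharp$ denotes the subalgebra $\mathcal{I}(X)+\mathbb{C}I$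 of $\mathcal{B}(X)$. For an algebra $A$, $\operatorname{IP}_n(A)$ is the set of idempotents in $M_n(A)$ and $\operatorname{IP}_\infty(A)=\bigcup_{n\ge1}\operatorname{IP}_n(A)$. For $P\in\operatorname{IP}_m(A)$, $Q\in\operatorname{IP}_n(A)$, $P\sim_0Q$ means $P=RT$, $Q=TR$ for some $R\in M_{m,n}(A)$, $T\in M_{n,m}(A)$. For unital $A$, $K_0(A)$ is the Grothendieck group of the semigroup $\operatorname{IP}_\infty(A)/{\sim_0}$ with addition $[P]+[Q]=[\operatorname{diag}(P,Q)]$, and $[P]_0$ is the class of $P$ in $K_0(A)$. For the non-unital algebra $A=\mathcal{I}(X)$, let $s:A^\sharp\to A^\sharp$, $s(B+\zeta I)=\zeta I$ ($B\in A$, $\zeta\in\mathbb{C}$), with entrywise extension $s_n$ to $M_n(A^\sharp)$; then $K_0(A)$ is the subgroup $\{[P]_0-[s_n(P)]_0 : n\in\mathbb{N},\ P\in\operatorname{IP}_n(A^\sharp)\}$ of $K_0(A^\sharp)$. Since $s_n(Q)=0$ for $Q\in\operatorname{IP}_n(\mathcal{F}(X))$, $[Q]_0\in K_0(\mathcal{I}(X))$. The rank of $Q\in\operatorname{IP}_n(\mathcal{F}(X))$ is $\dim(\operatorname{im}Q)$, with $Q$ regarded as an operator on $X^n$. *)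

(* Defs.v *)
From HB Require Import structures.
From mathcomp Require Import all_boot all_order all_algebra.
From mathcomp Require Import generic_quotient.
From mathcomp Require Import complex.
From mathcomp Require Import all_classical all_reals.
From mathcomp Require Import topology normedtype.

Set Implicit Arguments.
Unset Strict Implicit.
Unset Printing Implicit Defensive.

Import Order.TTheory GRing.Theory Num.Theory.
Import numFieldNormedType.Exports.

Local Open Scope classical_set_scope.
Local Open Scope quotient_scope.
Local Open Scope ring_scope.
Local Open Scope complex_scope.

(* Formal differences (a, b) and (c, d) are identified when
   a + d + k = c + b + k for some k, so that M need not be cancellative. *)
Section Grothendieck.
Variable M : nmodType.
Implicit Types (p q r : M * M).

Definition groth_eqv p q : bool :=
  `[< exists k, p.1 + q.2 + k = q.1 + p.2 + k >].

Fact groth_eqv_refl : reflexive groth_eqv.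
Proof. by move=> p; apply/asboolP; exists 0. Qed.

Fact groth_eqv_sym : symmetric groth_eqv.
Proof.
by move=> p q; apply/asboolP/asboolP => -[k hk]; exists k; rewrite hk.
Qed.

Fact groth_eqv_trans : transitive groth_eqv.
Proof.
move=> q p r /asboolP[k hk] /asboolP[l hl]; apply/asboolP.
exists (q.1 + q.2 + k + l).
rewrite [LHS](AC (2*4) ((1*4*5)*(3*2*6)))/= hk hl.
by rewrite [RHS](AC (2*4) ((3*2*5)*(1*4*6))).
Qed.

Canonical groth_equiv :=
  EquivRel groth_eqv groth_eqv_refl groth_eqv_sym groth_eqv_trans.

Definition groth := {eq_quot groth_eqv}.
HB.instance Definition _ := Choice.on groth.
HB.instance Definition _ := EqQuotient.on groth.

Definition to_groth (a : M) : groth := \pi_groth (a, 0).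

Definition groth_add (x y : groth) : groth :=
  \pi_groth ((repr x).1 + (repr y).1, (repr x).2 + (repr y).2).
Definition groth_opp (x : groth) : groth := \pi_groth ((repr x).2, (repr x).1).
Definition groth_zero : groth := \pi_groth (0, 0).

Lemma eq_grothP p q :
  (\pi_groth p = \pi_groth q) <-> exists k, p.1 + q.2 + k = q.1 + p.2 + k.
Proof.
split=> [/eqquotP/asboolP|h]; first by [].
by apply/eqquotP/asboolP.
Qed.

Lemma groth_reprP p :
  exists k, (repr (\pi_groth p)).1 + p.2 + k =
            p.1 + (repr (\pi_groth p)).2 + k.
Proof. by apply/eq_grothP; rewrite reprK. Qed.

Lemma groth_addE p q :
  groth_add (\pi_groth p) (\pi_groth q) = \pi_groth (p.1 + q.1, p.2 + q.2).
Proof.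
have [k hk] := groth_reprP p; have [l hl] := groth_reprP q.
apply/eq_grothP; exists (k + l) => /=.
by rewrite [LHS](AC (2*2*2) ((1*3*5)*(2*4*6)))/= hk hl
           [RHS](AC (2*2*2) ((1*3*5)*(2*4*6))).
Qed.

Lemma groth_oppE p : groth_opp (\pi_groth p) = \pi_groth (p.2, p.1).
Proof.
have [k hk] := groth_reprP p.
by apply/eq_grothP; exists k; rewrite /= [_ + p.1]addrC -hk [p.2 + _]addrC.
Qed.

Lemma grothW (P : groth -> Prop) : (forall p, P (\pi_groth p)) -> forall x, P x.
Proof. by move=> h x; rewrite -[x]reprK; exact: h. Qed.

Fact groth_addA : associative groth_add.
Proof.
elim/grothW=> p; elim/grothW=> q; elim/grothW=> r.
rewrite (groth_addE q r) (groth_addE p q) (groth_addE p) (groth_addE _ r).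
by rewrite /= !addrA.
Qed.

Fact groth_addC : commutative groth_add.
Proof.
elim/grothW=> p; elim/grothW=> q; rewrite (groth_addE p q) (groth_addE q p).
by congr (\pi_groth (_, _)); rewrite addrC.
Qed.

Fact groth_add0 : left_id groth_zero groth_add.
Proof.
elim/grothW=> p; rewrite (groth_addE (0, 0) p) /= !add0r.
by rewrite -surjective_pairing.
Qed.

Fact groth_addN : left_inverse groth_zero groth_opp groth_add.
Proof.
elim/grothW=> p; rewrite groth_oppE (groth_addE _ p).
by apply/eq_grothP; exists 0; rewrite /= !addr0 add0r addrC.
Qed.

HB.instance Definition _ := GRing.isZmodule.Build groth
  groth_addA groth_addC groth_add0 groth_addN.

Lemma to_grothD : {morph to_groth : a b / a + b}.
Proof. by move=> a b; rewrite [RHS]groth_addE /= addr0. Qed.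

End Grothendieck.

Section Idempotents.
Variable A : pzRingType.

Record idem (n : nat) := Idem { idem_mx :> 'M[A]_n;
                                idemP : idem_mx *m idem_mx == idem_mx }.
HB.instance Definition _ n := [isSub for @idem_mx n].
HB.instance Definition _ n := [Choice of idem n by <:].

Lemma idemE n (P : idem n) : P *m P = P.
Proof. exact/eqP/idemP. Qed.

Definition idem_equiv m n (P : idem m) (Q : idem n) : Prop :=
  exists (R : 'M[A]_(m, n)) (T : 'M[A]_(n, m)),
    P = R *m T :> 'M_m /\ Q = T *m R :> 'M_n.

Lemma idem_equiv_refl n (P : idem n) : idem_equiv P P.
Proof. by exists P, P; rewrite idemE. Qed.

Lemma idem_equiv_sym m n (P : idem m) (Q : idem n) :
  idem_equiv P Q -> idem_equiv Q P.
Proof. by move=> [R [T [hP hQ]]]; exists T, R. Qed.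

Lemma idem_equiv_trans m n p (P : idem m) (Q : idem n) (S : idem p) :
  idem_equiv P Q -> idem_equiv Q S -> idem_equiv P S.
Proof.
move=> [R [T [hP hQ]]] [R' [T' [hQ' hS]]]; exists (R *m R'), (T' *m T); split.
  by rewrite -[LHS]idemE hP !mulmxA -(mulmxA R T R) -hQ hQ' !mulmxA.
by rewrite -[LHS]idemE hS !mulmxA -(mulmxA T' R' T') -hQ' hQ !mulmxA.
Qed.

Fact idem_sum_subproof m n (P : idem m) (Q : idem n) :
  let D := block_mx P 0 0 Q : 'M[A]_(m + n) in D *m D == D.
Proof.
by rewrite /= mulmx_block !mulmx0 !mul0mx !addr0 !add0r !idemE.
Qed.

Definition idem_sum m n (P : idem m) (Q : idem n) : idem (m + n) :=
  Idem (idem_sum_subproof P Q).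

Definition idem0 n : idem n := @Idem n 0 (introT eqP (mulmx0 _ _)).

Lemma idem_sum_equiv m n m' n' (P : idem m) (Q : idem n)
    (P' : idem m') (Q' : idem n') :
  idem_equiv P P' -> idem_equiv Q Q' ->
  idem_equiv (idem_sum P Q) (idem_sum P' Q').
Proof.
move=> [R [T [hP hP']]] [S [U [hQ hQ']]].
exists (block_mx R 0 0 S), (block_mx T 0 0 U); rewrite !mulmx_block.
by rewrite !mulmx0 !mul0mx !addr0 !add0r /= hP hP' hQ hQ'.
Qed.

Lemma idem_sumC m n (P : idem m) (Q : idem n) :
  idem_equiv (idem_sum P Q) (idem_sum Q P).
Proof.
exists (block_mx 0 P Q 0), (block_mx 0 Q P 0); rewrite !mulmx_block.
by rewrite !mulmx0 !mul0mx !addr0 !add0r /= !idemE.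
Qed.

Lemma idem_equiv_cast m n (e : m = n) (P : idem m) (Q : idem n) :
  castmx (e, e) (P : 'M_m) = Q -> idem_equiv P Q.
Proof.
case: n / e Q => Q; rewrite castmx_id => h; have -> : P = Q by apply: val_inj.
exact: idem_equiv_refl.
Qed.

Lemma idem_sumA m n p (P : idem m) (Q : idem n) (S : idem p) :
  idem_equiv (idem_sum P (idem_sum Q S)) (idem_sum (idem_sum P Q) S).
Proof.
apply: (idem_equiv_cast (e := addnA m n p)) => /=.
have /= := @block_mxA A m n p m n p P 0 0 0 Q 0 0 0 S.
rewrite !row_mx0 !col_mx0 => ->.
by rewrite castmx_comp castmx_id.
Qed.

Lemma idem_sum0 m n (P : idem n) : idem_equiv (idem_sum (idem0 m) P) P.
Proof.
exists (col_mx 0 P), (row_mx 0 P).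
by rewrite mul_col_row mul_row_col !mulmx0 !mul0mx add0r !idemE.
Qed.

(* An element of IP_oo(A); the matrices have size n.+1 >= 1. *)
Definition idems := {n : nat & idem n.+1}.

Definition idems_eqv (P Q : idems) : bool :=
  `[< idem_equiv (tagged P) (tagged Q) >].

Fact idems_eqv_refl : reflexive idems_eqv.
Proof. by move=> P; apply/asboolP; exact: idem_equiv_refl. Qed.

Fact idems_eqv_sym : symmetric idems_eqv.
Proof. by move=> P Q; apply/asboolP/asboolP; exact: idem_equiv_sym. Qed.

Fact idems_eqv_trans : transitive idems_eqv.
Proof.
move=> Q P S /asboolP PQ /asboolP QS; apply/asboolP.
exact: idem_equiv_trans PQ QS.
Qed.

Canonical idems_equiv :=
  EquivRel idems_eqv idems_eqv_refl idems_eqv_sym idems_eqv_trans.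

Definition idem_classes := {eq_quot idems_eqv}.
HB.instance Definition _ := Choice.on idem_classes.
HB.instance Definition _ := EqQuotient.on idem_classes.

Definition idem_class n (P : idem n.+1) : idem_classes :=
  \pi_idem_classes (Tagged (fun n => idem n.+1) P).

Lemma eq_idem_class m n (P : idem m.+1) (Q : idem n.+1) :
  idem_class P = idem_class Q <-> idem_equiv P Q.
Proof. by split=> [/eqquotP/asboolP|h] //; apply/eqquotP/asboolP. Qed.

Lemma idem_classW (P : idem_classes -> Prop) :
  (forall n (Q : idem n.+1), P (idem_class Q)) -> forall x, P x.
Proof. by move=> h x; rewrite -[x]reprK; case: (repr x) => n Q; exact: h. Qed.

Definition idem_class_add (x y : idem_classes) : idem_classes :=
  idem_class (idem_sum (tagged (repr x)) (tagged (repr y))).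

Lemma idem_class_addE m n (P : idem m.+1) (Q : idem n.+1) :
  idem_class_add (idem_class P) (idem_class Q) = idem_class (idem_sum P Q).
Proof.
have h k (S : idem k.+1) : idem_equiv (tagged (repr (idem_class S))) S.
  apply/eq_idem_class; rewrite -[RHS]reprK.
  by case: (repr (idem_class S)).
by apply/eq_idem_class; exact: (idem_sum_equiv (h _ _) (h _ _)).
Qed.

Fact idem_class_addA : associative idem_class_add.
Proof.
elim/idem_classW=> m P; elim/idem_classW=> n Q; elim/idem_classW=> p S.
rewrite (idem_class_addE Q S) (idem_class_addE P Q).
rewrite (idem_class_addE P) (idem_class_addE _ S).
by apply/eq_idem_class; exact: (idem_sumA P Q S).
Qed.

Fact idem_class_addC : commutative idem_class_add.
Proof.
elim/idem_classW=> m P; elim/idem_classW=> n Q.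
rewrite (idem_class_addE P Q) (idem_class_addE Q P).
by apply/eq_idem_class; exact: (idem_sumC P Q).
Qed.

Fact idem_class_add0 : left_id (idem_class (idem0 1)) idem_class_add.
Proof.
elim/idem_classW=> n Q; rewrite (idem_class_addE (idem0 1) Q).
by apply/eq_idem_class; exact: (idem_sum0 1 Q).
Qed.

HB.instance Definition _ := GRing.isNmodule.Build idem_classes
  idem_class_addA idem_class_addC idem_class_add0.

Definition K0 := groth idem_classes.
HB.instance Definition _ := GRing.Zmodule.on K0.

Definition K0_class n (P : idem n.+1) : K0 := to_groth (idem_class P).

Lemma K0_classD m n (P : idem m.+1) (Q : idem n.+1) :
  K0_class P + K0_class Q = K0_class (idem_sum P Q).
Proof.
rewrite /K0_class -(idem_class_addE P Q).
by rewrite -[idem_class_add _ _]/(idem_class P + idem_class Q) to_grothD.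
Qed.

End Idempotents.


Section Dimension.
Variables (K : pzRingType) (V : lmodType K).

Definition has_dim (E : set V) (n : nat) : Prop :=
  exists e : 'I_n -> V,
    (forall a : 'I_n -> K, \sum_i a i *: e i = 0 -> forall i, a i = 0) /\
    E = [set \sum_i a i *: e i | a in [set: 'I_n -> K]].

Definition finite_dim (E : set V) : Prop := exists n, has_dim E n.

End Dimension.

Section BoundedOperators.
Variables (K : numFieldType) (X Y : normedModType K).

Definition is_bop : {pred X -> Y} :=
  fun f => `[< linear f /\ continuous f >].

Record bop := Bop { bop_fun :> X -> Y; bop_funP : bop_fun \in is_bop }.

HB.instance Definition _ := [isSub for bop_fun].
HB.instance Definition _ := [Choice of bop by <:].

Lemma is_bop_submod : submod_closed is_bop.
Proof.
split; first by apply/asboolP; split=> [a u v|x];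
  [rewrite scaler0 addr0|exact: cvg_cst].
move=> a f g /asboolP[fl fc] /asboolP[gl gc]; apply/asboolP; split.
  move=> b u v; rewrite /= !fctE fl gl !scalerDr !scalerA (mulrC a b).
  by rewrite addrACA.
by move=> x; apply: cvgD; [apply: cvgZr; exact: fc|exact: gc].
Qed.

HB.instance Definition _ :=
  GRing.isSubmodClosed.Build K (X -> Y) is_bop is_bop_submod.
HB.instance Definition _ := [SubChoice_isSubLmodule of bop by <:].

End BoundedOperators.

Section Composition.
Variable K : numFieldType.

Fact bop_comp_subproof (X Y Z : normedModType K) (g : bop Y Z) (f : bop X Y) :
  g \o f \in @is_bop K X Z.
Proof.
have /asboolP[gl gc] := bop_funP g; have /asboolP[fl fc] := bop_funP f.
apply/asboolP; split=> [a u v|x]; first by rewrite /= fl gl.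
by apply: continuous_comp; [exact: fc|exact: gc].
Qed.

Definition bop_comp (X Y Z : normedModType K) (g : bop Y Z) (f : bop X Y) :
  bop X Z := Bop (bop_comp_subproof g f).

Fact bop_id_subproof (X : normedModType K) : idfun \in @is_bop K X X.
Proof. by apply/asboolP; split=> // x; exact: cvg_id. Qed.

Definition bop_id (X : normedModType K) : bop X X := Bop (bop_id_subproof X).

Lemma bopP (X Y : normedModType K) (f g : bop X Y) : f =1 g <-> f = g.
Proof. by split=> [h|->//]; apply: val_inj; apply/funext. Qed.

Lemma bop_linear (X Y : normedModType K) (f : bop X Y) : linear f.
Proof. by have /asboolP[] := bop_funP f. Qed.

Lemma bop_continuous (X Y : normedModType K) (f : bop X Y) : continuous f.
Proof. by have /asboolP[] := bop_funP f. Qed.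

HB.instance Definition _ (X Y : normedModType K) (f : bop X Y) :=
  GRing.isLinear.Build K X Y _ f (bop_linear f).

Variable X : normedModType K.
Let comp := @bop_comp X X X.

Fact bop_compA : associative comp.
Proof. by move=> f g h; apply/bopP. Qed.
Fact bop_comp1l : left_id (bop_id X) comp.
Proof. by move=> f; apply/bopP. Qed.
Fact bop_comp1r : right_id (bop_id X) comp.
Proof. by move=> f; apply/bopP. Qed.
Fact bop_compDl : left_distributive comp +%R.
Proof. by move=> f g h; apply/bopP. Qed.
Fact bop_compDr : right_distributive comp +%R.
Proof. by move=> f g h; apply/bopP => x; exact: linearD. Qed.

HB.instance Definition _ := GRing.Zmodule_isPzRing.Build (bop X X)
  bop_compA bop_comp1l bop_comp1r bop_compDl bop_compDr.

End Composition.

Section OperatorNorm.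
Variables (R : realType) (X Y : normedModType R[i]).
Implicit Types f g : bop X Y.

Definition opnorm f : R :=
  sup [set complex.Re `|f x| | x in [set x : X | `|x| <= 1]].

Let Re_norm (V : normedModType R[i]) (x : V) : (complex.Re `|x|)%:C = `|x|.
Proof. by rewrite RRe_real// normr_real. Qed.

Let opnorm_has_sup f :
  has_sup [set complex.Re `|f x| | x in [set x : X | `|x| <= 1]].
Proof.
split; first by exists (complex.Re `|f 0|), 0 => //=; rewrite normr0 ler01.
have /linear_bounded_continuous/linear_boundedP := @bop_continuous _ _ _ f.
move=> /pinfty_ex_gt0[M M0 hM]; exists (complex.Re M) => _ [x /= x1 <-].
rewrite -lecR Re_norm RRe_real ?gtr0_real//.
by rewrite (le_trans (hM x))// ler_piMr// ltW.
Qed.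

Lemma opnorm_ge0 f : 0 <= opnorm f.
Proof.
apply: (sup_upper_bound (opnorm_has_sup f)).
by exists 0; rewrite /= ?normr0 ?ler01// linear0 normr0.
Qed.

Lemma opnorm_ub f x : `|f x| <= (opnorm f)%:C * `|x|.
Proof.
have [->|x0] := eqVneq x 0; first by rewrite linear0 !normr0 mulr0.
have nx0 : 0 < `|x| by rewrite normr_gt0.
rewrite -ler_pdivrMr// mulrC -[`|x|^-1]ger0_norm ?invr_ge0//.
rewrite -normrZ -linearZ -Re_norm lecR.
apply: (sup_upper_bound (opnorm_has_sup f)); exists (`|x|^-1 *: x) => //=.
by rewrite normrZ ger0_norm ?invr_ge0// mulVf// gt_eqF.
Qed.

Lemma opnorm_le f (M : R) : 0 <= M ->
  (forall x, `|f x| <= M%:C * `|x|) -> opnorm f <= M.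
Proof.
move=> M0 hM; apply: ge_sup.
  by exists (complex.Re `|f 0|), 0 => //=; rewrite normr0 ler01.
move=> _ [x /= x1 <-]; rewrite -lecR Re_norm (le_trans (hM x))//.
by rewrite ler_piMr// lecR.
Qed.

Let normC f : R[i] := (opnorm f)%:C.

Fact opnorm_triangle f g : normC (f + g) <= normC f + normC g.
Proof.
rewrite /normC -rmorphD/= lecR; apply: opnorm_le => [|x].
  exact: addr_ge0 (opnorm_ge0 f) (opnorm_ge0 g).
rewrite rmorphD/= mulrDl (le_trans (ler_normD (f x) (g x)))//.
exact: lerD (opnorm_ub f x) (opnorm_ub g x).
Qed.

Let opnormZ_le (l : R[i]) f : normC (l *: f) <= `|l| * normC f.
Proof.
have [r r0 lE] : exists2 r : R, 0 <= r & `|l| = r%:C.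
  have nl : (complex.Re `|l|)%:C = `|l| by apply: RRe_real; exact: normr_real.
  exists (complex.Re `|l|); last exact: esym.
  by rewrite -lecR nl; exact: normr_ge0.
rewrite /normC lE -rmorphM lecR; apply: opnorm_le => [|x].
  exact: mulr_ge0 r0 (opnorm_ge0 f).
have -> : (l *: f) x = l *: f x by [].
rewrite normrZ lE rmorphM -mulrA ler_wpM2l ?lecR//; exact: opnorm_ub.
Qed.

Fact opnorm_scale (l : R[i]) f : normC (l *: f) = `|l| * normC f.
Proof.
apply/eqP; rewrite eq_le opnormZ_le /=.
have [->|l0] := eqVneq l 0; first by rewrite normr0 mul0r lecR opnorm_ge0.
rewrite mulrC -ler_pdivlMr ?normr_gt0// mulrC -normfV.
by rewrite -{1}[f](scalerK l0) opnormZ_le.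
Qed.

Fact opnorm_eq0 f : normC f = 0 -> f = 0.
Proof.
move=> f0; apply/bopP => x; apply/eqP; rewrite -normr_le0.
by rewrite (le_trans (opnorm_ub f x))// -/(normC f) f0 mul0r.
Qed.

HB.instance Definition _ := Lmodule_isNormed.Build R[i] (bop X Y)
  opnorm_triangle opnorm_scale opnorm_eq0.

End OperatorNorm.

(* Every Banach space is infinite-dimensional here, so that operator ideals
   range over infinite-dimensional spaces only. *)
Record banach (R : realType) := Banach {
  banach_sort :> completeNormedModType R[i];
  _ : ~ finite_dim [set: banach_sort] }.

Section Ideals.
Variable R : realType.

Definition is_subspace (V : lmodType R[i]) (E : set V) : Prop :=
  E 0 /\ forall (a : R[i]) (u v : V), E u -> E v -> E (a *: u + v).

Record operator_ideal := OperatorIdeal {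
  ideal_set :> forall X Y : banach R, set (bop X Y);
  ideal_subspace : forall X Y, is_subspace (@ideal_set X Y);
  ideal_comp : forall (W X Y Z : banach R)
      (r : bop W X) (s : bop X Y) (t : bop Y Z),
    ideal_set s -> ideal_set (bop_comp t (bop_comp s r)) }.
Arguments ideal_set : clear implicits.

Definition closed_ideal (I : operator_ideal) : Prop :=
  forall X Y : banach R, closed (I X Y).

Definition nonzero_ideal (I : operator_ideal) : Prop :=
  forall X Y : banach R, I X Y <> [set 0].

Definition finite_rank (X Y : banach R) : set (bop X Y) :=
  [set f | finite_dim (range f)].

Definition bounded_below_on (X Y : banach R) (f : bop X Y) (E : set X) : Prop :=
  exists2 c : R[i], 0 < c & forall x, E x -> c * `|x| <= `|f x|.

Definition strictly_singular (X Y : banach R) : set (bop X Y) :=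
  [set f | forall E : set X,
     is_subspace E -> bounded_below_on f E -> finite_dim E].

Definition mx_op (X : banach R) n (P : 'M[bop X X]_n)
    (x : {ffun 'I_n -> X}) : {ffun 'I_n -> X} :=
  [ffun i => \sum_j P i j (x j)].

Definition has_rank (X : banach R) n (P : 'M[bop X X]_n) (k : nat) : Prop :=
  has_dim (range (mx_op P)) k.

Section Sharp.
Variables (I : operator_ideal) (X : banach R).

Definition in_sharp : {pred bop X X} :=
  fun a => `[< exists (b : bop X X) (z : R[i]), I X X b /\ a = b + z *: bop_id X >].

Record sharp := Sharp { sharp_val :> bop X X; sharpP : sharp_val \in in_sharp }.

HB.instance Definition _ := [isSub for sharp_val].
HB.instance Definition _ := [Choice of sharp by <:].

Let sub0 : I X X 0. Proof. by case: (ideal_subspace I X X). Qed.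

Let subZD (a : R[i]) (f g : bop X X) : I X X f -> I X X g -> I X X (a *: f + g).
Proof. by case: (ideal_subspace I X X) => _; exact. Qed.

Let subM (s t : bop X X) : I X X s -> I X X (s * t) /\ I X X (t * s).
Proof.
move=> hs; split.
  have := ideal_comp t (1 : bop X X) hs.
  by congr (I X X _); apply/bopP.
have := ideal_comp (1 : bop X X) t hs.
by congr (I X X _); apply/bopP.
Qed.

Fact in_sharp_scaler : submod_closed in_sharp.
Proof.
split; first by apply/asboolP; exists 0, 0; rewrite scale0r addr0.
move=> a f g /asboolP[b [z [hb ->]]] /asboolP[c [w [hc ->]]].
apply/asboolP; exists (a *: b + c), (a * z + w); split; first exact: subZD.
by rewrite scalerDr scalerA addrACA -scalerDl.
Qed.

Fact in_sharp_subring : subring_closed in_sharp.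
Proof.
split.
- by apply/asboolP; exists 0, 1; rewrite scale1r add0r.
- move=> f g fs gs; have [_ h] := in_sharp_scaler.
  by rewrite addrC -scaleN1r h.
- move=> f g /asboolP[b [z [hb ->]]] /asboolP[c [w [hc ->]]].
  apply/asboolP; exists (b * c + (w *: b + z *: c)), (z * w); split.
    rewrite -[b * c]scale1r; apply: subZD; first exact: (subM _ hb).1.
    by apply: subZD; rewrite // -[_ *: c]addr0; exact: subZD.
  apply/bopP => x; rewrite -[LHS]/(b (c x + w *: x) + z *: (c x + w *: x)).
  rewrite -[RHS]/(b (c x) + (w *: b x + z *: c x) + (z * w) *: x).
  by rewrite linearD linearZ scalerDr scalerA !addrA.
Qed.

HB.instance Definition _ :=
  GRing.isSubringClosed.Build (bop X X) in_sharp in_sharp_subring.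
HB.instance Definition _ :=
  GRing.isScaleClosed.Build R[i] (bop X X) in_sharp
    (GRing.subsemimod_closedZ in_sharp_scaler).
HB.instance Definition _ :=
  GRing.SubChoice_isSubPzRing.Build _ _ sharp (GRing.subringClosedP _).
HB.instance Definition _ := [SubZmodule_isSubLmodule of sharp by <:].

(* The zeta of the decomposition a = B + zeta I; it is unique as soon as the
   identity is not in I(X), and an arbitrary such scalar otherwise. *)
Definition scalar_coef (a : sharp) : R[i] :=
  xget 0 [set z : R[i] | I X X (sharp_val a - z *: bop_id X)].

Definition scalar_part (a : sharp) : sharp :=
  scalar_coef a *: (1 : sharp).

(* K_0 of the non-unital algebra I(X), as a subset of K_0(I(X)^#). *)
Definition K0_ideal : set (K0 sharp) :=
  [set x | exists (n : nat) (P sP : idem sharp n.+1),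
     sP = map_mx scalar_part P :> 'M_n.+1 /\ x = K0_class P - K0_class sP].

End Sharp.
End Ideals.
Arguments ideal_set {R} o X Y : rename.
Arguments finite_rank {R} X Y.
Arguments strictly_singular {R} X Y.
Arguments sharp {R} I X.
Arguments sharp_val {R I X}.
Arguments K0_ideal {R} I X.

(* Main.v *)
(* Everything takes place in A = I(X) + C 1. By Kato's argument, if S is
   strictly singular then 1 + S is bounded below on a finite intersection of
   kernels of functionals. Invertibility up to a finite rank perturbation is
   an open property, and it passes to limits bounded below on such a subspace,
   so it propagates along t |-> 1 + t S from t = 0: some finite rank
   perturbation of 1 + S is invertible. Schur complements extend this to
   matrices over A with scalar part 1, and the inverses stay in A.

   Let P be an idempotent with scalar part E. Then U = P E + (1 - P)(1 - E)
   has scalar part 1 and P U = U E, so an invertible finite rank perturbation V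
   of U makes P a finite rank perturbation of V E V^-1, which is equivalent to
   E. Idempotents differing by a finite rank matrix become equivalent after
   splitting off finitely many rank one idempotents, so [P] - [E] is a multiple
   of the class of a rank one idempotent e. If k [e] = 0 with k > 0, then
   diag(e, ..., e) + 1_N = R T and T R = 1_N for some N, and the square block of
   R over 1_N has a right inverse, hence a left inverse, because 1 plus a
   strictly singular operator has index zero; this forces e = 0. *)

Require Import Defs.
From HB Require Import structures.
From mathcomp Require Import all_boot all_order all_algebra.
From mathcomp Require Import complex ring lra.
From mathcomp Require Import all_classical all_reals.
From mathcomp Require Import topology normedtype sequences.

Set Implicit Arguments.
Unset Strict Implicit.
Unset Printing Implicit Defensive.

Import Order.TTheory GRing.Theory Num.Theory.
Import numFieldNormedType.Exports.

Local Open Scope classical_set_scope.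
Local Open Scope ring_scope.
Local Open Scope complex_scope.

(** * Idempotents over a ring with a minimal idempotent e and a character *)

Section MatrixUnits.
Variable A : pzRingType.

Definition mx_unit n (U : 'M[A]_n) :=
  exists V : 'M[A]_n, U *m V = 1%:M /\ V *m U = 1%:M.

Lemma mx_unitM n (U V : 'M[A]_n) : mx_unit U -> mx_unit V -> mx_unit (U *m V).
Proof.
move=> [U' [UU' U'U]] [V' [VV' V'V]]; exists (V' *m U'); split.
  by rewrite mulmxA -(mulmxA U) VV' mulmx1.
by rewrite mulmxA -(mulmxA V') U'U mulmx1.
Qed.

End MatrixUnits.

Section Corner.
Variables (F : fieldType) (A : pzRingType) (iota : {rmorphism F -> A}).
Variables (e : A) (chi : A -> F).
Hypothesis iotaC : forall z a, iota z * a = a * iota z.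
Hypothesis e_idem : e * e = e.
Hypothesis e_neq0 : e != 0.
Hypothesis cornerE : forall b, e * b * e = iota (chi b) * e.

(** Matrices that factor through finitely many copies of [e]. When [e] is a rank one projection they
    play the part of the finite rank operators. *)
Definition mx_finite m n (M : 'M[A]_(m, n)) :=
  exists r (a : 'M[A]_(m, r)) (c : 'M[A]_(r, n)), M = a *m e%:M *m c.

Lemma mx_finite0 m n : mx_finite (0 : 'M[A]_(m, n)).
Proof. by exists 0, 0, 0; rewrite mulmx0. Qed.

Lemma mx_finiteD m n (M N : 'M[A]_(m, n)) :
  mx_finite M -> mx_finite N -> mx_finite (M + N).
Proof.
move=> [r [a [c ->]]] [s [b [d ->]]]; exists (r + s), (row_mx a b), (col_mx c d).
by rewrite (scalar_mx_block r s) mul_row_block !mulmx0 addr0 add0r mul_row_col.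
Qed.

Lemma mx_finiteMl m n p (N : 'M[A]_(p, m)) (M : 'M[A]_(m, n)) :
  mx_finite M -> mx_finite (N *m M).
Proof. by move=> [r [a [c ->]]]; exists r, (N *m a), c; rewrite !mulmxA. Qed.

Lemma mx_finiteMr m n p (M : 'M[A]_(m, n)) (N : 'M[A]_(n, p)) :
  mx_finite M -> mx_finite (M *m N).
Proof. by move=> [r [a [c ->]]]; exists r, a, (c *m N); rewrite !mulmxA. Qed.

Lemma mx_finiteN m n (M : 'M[A]_(m, n)) : mx_finite M -> mx_finite (- M).
Proof. by move=> [r [a [c ->]]]; exists r, (- a), c; rewrite !mulNmx. Qed.

Let E n : 'M[A]_n := e%:M.

Let EE n : E n *m E n = E n.
Proof. by rewrite /E -scalar_mxM e_idem. Qed.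

Let map_iotaC m n (K : 'M[F]_(m, n)) :
  E m *m map_mx iota K = map_mx iota K *m E n.
Proof.
apply/matrixP => i j; rewrite mul_scalar_mx !mxE (bigD1 j)//= big1 => [|k kj].
  by rewrite !mxE eqxx addr0 mulr1n iotaC.
by rewrite !mxE (negbTE kj) mulr0n mulr0.
Qed.

Let corner_mxE m n (M : 'M[A]_(m, n)) :
  E m *m M *m E n = map_mx iota (map_mx chi M) *m E n.
Proof.
apply/matrixP => i j; rewrite mul_scalar_mx !mxE.
by apply: eq_bigr => k _; rewrite !mxE; case: eqVneq => [->|_];
  rewrite ?mulr1n ?cornerE// !mulr0.
Qed.

Let iota_e_eq0 z : iota z * e = 0 -> z = 0.
Proof.
move=> ze; apply/eqP; apply: contra_neqT e_neq0 => z0.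
by rewrite -[e]mul1r -(rmorph1 iota) -(mulVf z0) rmorphM -mulrA ze mulr0.
Qed.

(** Sandwiching between copies of [e] leaves only scalars, so the question reduces to
    [M = 1 + chi (c a)] over the field. If [M] is invertible, [1 - a N c] with [N = M^-1 E] is the
    inverse. Otherwise a kernel vector of [M] yields a column [b] killed by [1 + a E c]; regularity
    gives [b = 0], which forces that kernel vector to vanish. *)
Let left_regular_unit1 n r (a : 'M[A]_(n, r)) (c : 'M[A]_(r, n)) :
  (forall b : 'cV[A]_n, (1%:M + a *m E r *m c) *m b = 0 -> b = 0) ->
  mx_unit (1%:M + a *m E r *m c).
Proof.
move=> reg; pose M := 1%:M + map_mx chi (c *m a) : 'M[F]_r.
have ME : E r + E r *m (c *m a) *m E r = map_mx iota M *m E r.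
  by rewrite corner_mxE map_mxD map_mx1 mulmxDl mul1mx.
have [Mu|] := boolP (M \in unitmx).
  pose N := map_mx iota (invmx M) *m E r.
  have EN : E r *m N = N by rewrite mulmxA map_iotaC -mulmxA EE.
  have NE : N *m E r = N by rewrite -mulmxA EE.
  have MN : N + E r *m (c *m a) *m N = E r.
    transitivity ((E r + E r *m (c *m a) *m E r) *m N).
      by rewrite mulmxDl EN -(mulmxA _ (E r) N) EN.
    by rewrite ME -mulmxA EN mulmxA -map_mxM mulmxV// map_mx1 mul1mx.
  have NM : N + N *m (c *m a) *m E r = E r.
    transitivity (N *m (E r + E r *m (c *m a) *m E r)).
      by rewrite mulmxDr NE !mulmxA NE.
    rewrite ME mulmxA -(mulmxA _ (E r)) map_iotaC mulmxA -map_mxM.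
    by rewrite mulVmx// map_mx1 mul1mx EE.
  exists (1%:M - a *m N *m c); split.
    rewrite mulmxBr mulmx1 mulmxDl mul1mx.
    have {1}-> : a *m E r *m c = a *m N *m c + a *m E r *m c *m (a *m N *m c).
      by rewrite -{1}MN mulmxDr mulmxDl !mulmxA.
    by rewrite addrK.
  rewrite mulmxDr mulmx1 mulmxBl mul1mx.
  have {1}-> : a *m E r *m c = a *m N *m c + a *m N *m c *m (a *m E r *m c).
    by rewrite -{1}NM mulmxDr mulmxDl !mulmxA.
  by rewrite addrK subrK.
rewrite -unitmx_tr -row_free_unit -kermx_eq0 => /rowV0Pn[v].
move=> /sub_kermxP vM v0; exfalso.
have Mk : M *m v^T = 0 by apply: trmx_inj; rewrite trmx_mul trmxK trmx0.
pose k := map_mx iota v^T; pose b := a *m E r *m k.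
have MEk : (E r + E r *m (c *m a) *m E r) *m k = 0.
  rewrite ME -mulmxA map_iotaC mulmxA -map_mxM Mk.
  by rewrite map_mx0 mul0mx.
have b0 : b = 0.
  apply: reg; rewrite mulmxDl mul1mx /b !mulmxA.
  rewrite -!(mulmxA a) -mulmxDr; move: MEk; rewrite mulmxDl !mulmxA => ->.
  by rewrite mulmx0.
have aEk : a *m (E r *m k) = 0 by rewrite mulmxA.
have : E r *m k = 0.
  by move: MEk; rewrite mulmxDl -!mulmxA aEk !mulmx0 addr0.
rewrite map_iotaC => /matrixP kE; move/eqP: v0; apply.
apply/rowP => i; rewrite [RHS]mxE; apply: iota_e_eq0.
have := kE i 0; rewrite mxE (bigD1 0)//= big1 => [|j]; last by rewrite ord1.
by rewrite !mxE addr0.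
Qed.

(* The analogue of "index zero and injective implies invertible". *)
Lemma left_regular_unit n (V G : 'M[A]_n) :
  mx_unit V -> mx_finite G ->
  (forall b : 'cV[A]_n, (V + G) *m b = 0 -> b = 0) -> mx_unit (V + G).
Proof.
move=> Vu [r [a [c ->]]] reg; have [W [VW WV]] := Vu.
have VE : V + a *m e%:M *m c = V *m (1%:M + (W *m a) *m E r *m c).
  by rewrite mulmxDr mulmx1 !mulmxA VW mul1mx.
rewrite VE; apply: mx_unitM => //; apply: left_regular_unit1 => b hb.
by apply: reg; rewrite VE -mulmxA hb mulmx0.
Qed.

(** Since [W = V^-1 - V^-1 G W], the right inverse is itself a finite perturbation of a unit, and it
    is left regular because it has a left inverse. So [W] is a unit, with inverse [V + G]. *)
Lemma right_inverse_unit n (V G W : 'M[A]_n) :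
  mx_unit V -> mx_finite G -> (V + G) *m W = 1%:M -> W *m (V + G) = 1%:M.
Proof.
move=> [V' [VV' V'V]] Gf VGW.
have WE : W = V' + - (V' *m G *m W).
  apply/eqP; rewrite eq_sym subr_eq eq_sym; apply/eqP.
  have := congr1 (mulmx V') VGW.
  by rewrite mulmx1 mulmxDl mulmxDr !mulmxA V'V mul1mx.
have [|||Z [WZ ZW]] := @left_regular_unit n V' (- (V' *m G *m W)).
- by exists V.
- exact/mx_finiteN/mx_finiteMr/mx_finiteMl.
- rewrite -WE => b Wb; rewrite -[b]mul1mx -VGW -mulmxA Wb.
  by rewrite mulmx0.
rewrite -WE in WZ ZW; rewrite -[LHS]mulmx1 -WZ -mulmxA [_ *m (W *m Z)]mulmxA.
by rewrite VGW mul1mx.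
Qed.

(** * Scalar parts and Schur complements *)

Variable sigma : {rmorphism A -> F}.
Hypothesis sigmaK : forall z, sigma (iota z) = z.
Hypothesis sigma_e : sigma e = 0.
Hypothesis e_right : forall b, e * b != 0 -> exists c, e * b * c * e = e.
Hypothesis fredholm : forall a, sigma a = 1 ->
  exists2 G : 'M[A]_1, mx_finite G & mx_unit (a%:M + G).

(** Block LDU factorization: the middle factor is diagonal, with entries [u] and the Schur
    complement, and the outer factors are unitriangular. *)
Let block_unit m n (u : 'M[A]_m) (b : 'M[A]_(m, n)) (c : 'M[A]_(n, m))
    (d : 'M[A]_n) u' :
  u *m u' = 1%:M -> u' *m u = 1%:M -> mx_unit (d - c *m u' *m b) ->
  mx_unit (block_mx u b c d).
Proof.
move=> uu' u'u [w [dw wd]].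
have -> : block_mx u b c d = block_mx 1%:M 0 (c *m u') 1%:M *m
    block_mx u 0 0 (d - c *m u' *m b) *m block_mx 1%:M (u' *m b) 0 1%:M.
  rewrite !mulmx_block !mulmx0 !mul0mx !mulmx1 !mul1mx !addr0 !add0r.
  by rewrite -[c *m u' *m u]mulmxA u'u mulmx1 !mulmxA uu' mul1mx addrC subrK.
apply: mx_unitM; first apply: mx_unitM.
- exists (block_mx 1%:M 0 (- (c *m u')) 1%:M).
  rewrite !mulmx_block !mulmx0 !mul0mx !mulmx1 !mul1mx !addr0 !add0r.
  by rewrite subrr addNr -scalar_mx_block.
- exists (block_mx u' 0 0 w).
  rewrite !mulmx_block !mulmx0 !mul0mx !addr0 !add0r uu' u'u dw wd.
  by rewrite -scalar_mx_block.
- exists (block_mx 1%:M (- (u' *m b)) 0 1%:M).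
  rewrite !mulmx_block !mulmx0 !mul0mx !mulmx1 !mul1mx !addr0 !add0r.
  by rewrite subrr addNr -scalar_mx_block.
Qed.

Lemma mx_finite_diag m n (M : 'M[A]_m) (N : 'M[A]_n) :
  mx_finite M -> mx_finite N -> mx_finite (block_mx M 0 0 N).
Proof.
move=> [r [a [c ->]]] [s [b [d ->]]].
exists (r + s), (block_mx a 0 0 b), (block_mx c 0 0 d).
rewrite (scalar_mx_block r s) !mulmx_block.
by rewrite !mulmx0 !mul0mx !addr0 !add0r !mul0mx.
Qed.

(* Schur complements: a finite rank correction makes the upper left entry
   invertible, and the complement again has scalar part 1. *)
Lemma fredholm_mx n (U : 'M[A]_n) : map_mx sigma U = 1%:M ->
  exists2 G, mx_finite G & mx_unit (U + G).
Proof.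
elim: n U => [|n IHn] U sU.
  exists 0; first exact: mx_finite0.
  by exists 0; split; apply/matrixP => -[].
have := sU; rewrite -[U](@submxK _ 1 n 1 n) (@map_block_mx _ _ sigma 1 n 1 n).
rewrite (scalar_mx_block 1 n) => /(@eq_block_mx _ 1 n 1 n)[].
set u := ulsubmx _; set b := ursubmx _; set c := dlsubmx _; set d := drsubmx _.
move=> su _ sc sd.
have [G1 G1f] : exists2 G : 'M[A]_1, mx_finite G & mx_unit (u + G).
  rewrite [u]mx11_scalar; apply: fredholm.
  by have /matrixP/(_ 0 0) := su; rewrite !mxE.
move=> [u' [uu' u'u]].
have [|G2 G2f G2u] := IHn (d - c *m u' *m b).
  by rewrite map_mxB !map_mxM sd sc !mul0mx subr0.
exists (block_mx G1 0 0 G2 : 'M_(1 + n)); first exact: (@mx_finite_diag 1 n).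
rewrite (@add_block_mx A 1 n 1 n) !addr0.
by apply: (@block_unit 1 n _ _ _ _ _ uu' u'u); rewrite addrAC.
Qed.

(** * Classes of idempotents in K_0 *)

Fact corner_idem_subproof k : E k *m E k == E k.
Proof. by apply/eqP; exact: EE. Qed.

Definition corner_idem k : idem A k := Idem (corner_idem_subproof k).

Let g : K0 A := K0_class (corner_idem 1).

Lemma eq_K0_class m n (P : idem A m.+1) (Q : idem A n.+1) :
  idem_equiv P Q -> K0_class P = K0_class Q.
Proof. by move=> PQ; congr to_groth; apply/eq_idem_class. Qed.

Lemma K0_class0 n : K0_class (idem0 A n.+1) = 0.
Proof.
rewrite (@eq_K0_class _ 0 _ (idem0 A 1))//.
by exists 0, 0; rewrite !mulmx0.
Qed.

(** The summand [x *m f] is an idempotent orthogonal to [P1] and equivalent to [e]; the row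
    [(P1, x)] and the column [(P1, f)] implement the equivalence of [P] with [diag(P1, e)]. *)
Lemma K0_class_split n (P P1 : idem A n.+1) (x : 'M[A]_(n.+1, 1))
    (f : 'M[A]_(1, n.+1)) :
  idem_mx P = idem_mx P1 + x *m f -> f *m x = E 1 -> P1 *m x = 0 -> f *m P1 = 0 ->
  x *m E 1 = x -> E 1 *m f = f ->
  K0_class P = K0_class P1 + g.
Proof.
move=> PE fx P1x fP1 xE Ef; rewrite K0_classD.
suff h : idem_equiv P (idem_sum P1 (corner_idem 1)) by exact: eq_K0_class h.
exists (row_mx P1 x), (col_mx P1 f); rewrite mul_row_col mul_col_row PE idemE.
by rewrite P1x fP1 fx.
Qed.

(** The range of [P] is cut down by the rows of [E r *m c], one at a time. A row either vanishes on
    the current range, and nothing changes, or it allows a copy of [e] to be split off, at the cost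
    of one [g]. The range of [P1] is described by the columns that [P1] fixes. *)
Lemma K0_split_functionals n r (P : idem A n.+1) (c : 'M[A]_(r, n.+1)) :
  exists (P1 : idem A n.+1) (k : nat),
    (forall m (y : 'M[A]_(n.+1, m)),
       P1 *m y = y <-> P *m y = y /\ E r *m c *m y = 0) /\
    K0_class P = K0_class P1 + g *+ k.
Proof.
elim: r c => [|r IHr] c.
  exists P, 0; split; last by rewrite addr0.
  move=> m y; split=> [|[]//]; split => //.
  by rewrite flatmx0.
have [P1 [k [P1E PP1]]] := IHr (@dsubmx _ 1 r n.+1 c).
pose f := E 1 *m @usubmx _ 1 r n.+1 c.
have cE m (y : 'M[A]_(n.+1, m)) : E r.+1 *m c *m y = 0 <->
    f *m y = 0 /\ E r *m @dsubmx _ 1 r n.+1 c *m y = 0.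
  have -> : E r.+1 *m c = col_mx f (E r *m @dsubmx _ 1 r n.+1 c).
    have := mul_block_col (E 1) 0 0 (E r) (@usubmx _ 1 r n.+1 c)
      (@dsubmx _ 1 r n.+1 c).
    by rewrite vsubmxK -scalar_mx_block !mul0mx add0r addr0.
  rewrite (@mul_col_mx _ 1 r); split.
    by move=> /eqP; rewrite (@col_mx_eq0 _ 1 r) => /andP[/eqP-> /eqP->].
  by move=> [-> ->]; rewrite (@col_mx0 _ 1 r).
have Ef : E 1 *m f = f by rewrite mulmxA EE.
have [fP1|fP1] := eqVneq (f *m P1) 0.
  exists P1, k; split=> // m y; split=> [P1y|[Py /cE[_ cy]]].
    have [Py cy] := (P1E _ _).1 P1y; split=> //; apply/cE; split=> //.
    by rewrite -P1y mulmxA fP1 mul0mx.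
  exact/P1E.
have [j fP1j] : exists j, (f *m P1) 0 j != 0.
  apply/existsP; apply: contra_neqT fP1 => /existsPn h.
  apply/rowP => j; rewrite [RHS]mxE; apply/eqP.
  by have := h j; rewrite negbK.
have efP1 : e * (f *m P1) 0 j = (f *m P1) 0 j.
  by rewrite -[in RHS]Ef -mulmxA mul_scalar_mx [RHS]mxE.
have [c0 c0E] : exists c0, e * (f *m P1) 0 j * c0 * e = e.
  by apply: e_right; rewrite efP1.
(* A vector in the range of [P1]: column [j], normalized on the right by [c0 * e] so that [f *m x]
   is exactly [e]. *)
pose x : 'M[A]_(n.+1, 1) := P1 *m (delta_mx j 0 *m (c0 * e)%:M).
have xE : x *m E 1 = x by rewrite -!mulmxA -scalar_mxM -mulrA e_idem.
have P1x : P1 *m x = x by rewrite mulmxA idemE.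
have fx : f *m x = E 1.
  rewrite /x mulmxA mulmxA -colE; apply/matrixP => i l; rewrite !ord1.
  rewrite mxE big_ord1 mxE -efP1 [(c0 * e)%:M 0 0]mxE [RHS]mxE !mulr1n.
  by rewrite mulrA.
(* Composing [f] with [P1] makes [x *m f1] a subidempotent of [P1], so that [P1 - x *m f1] is again
   idempotent. *)
pose f1 := f *m P1.
have f1x : f1 *m x = E 1 by rewrite -mulmxA P1x.
have f1P1 : f1 *m P1 = f1 by rewrite -mulmxA idemE.
have Ef1 : E 1 *m f1 = f1 by rewrite mulmxA Ef.
have f1E : f1 = f *m P1 by [].
clearbody x f1.
have D_idem : (idem_mx P1 - x *m f1) *m (idem_mx P1 - x *m f1) ==
    idem_mx P1 - x *m f1.
  apply/eqP; rewrite mulmxBr !mulmxBl idemE !mulmxA P1x -(mulmxA x) f1P1.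
  by rewrite -(mulmxA x) f1x xE subrr subr0.
pose P2 := Idem D_idem.
exists P2, k.+1; split.
  move=> m y; split.
    move=> P2y; have P1y : P1 *m y = y.
      rewrite -P2y mulmxA; congr (_ *m _).
      by rewrite /= mulmxBr idemE mulmxA P1x.
    have [Py cy] := (P1E _ _).1 P1y; split=> //; apply/cE; split=> //.
    rewrite -P2y mulmxA /= mulmxBr mulmxA fx Ef1.
    by rewrite f1E subrr mul0mx.
  move=> [Py /cE[fy cy]]; have P1y : P1 *m y = y by apply/P1E.
  by rewrite /= mulmxBl P1y f1E -(mulmxA x) -(mulmxA f) P1y fy mulmx0 subr0.
rewrite PP1 mulrS addrA; congr (_ + _).
apply: (@K0_class_split _ _ _ x f1) => //=.
- by rewrite subrK.
- by rewrite mulmxBl P1x -mulmxA f1x xE subrr.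
- by rewrite mulmxBr f1P1 mulmxA f1x Ef1 subrr.
Qed.

(** [P] and [Q] agree on the columns killed by [E r *m c]. Cutting both ranges by these functionals
    therefore gives idempotents [P1], [Q1] with the same range, which are equivalent through each
    other; only the numbers of copies of [e] split off differ. *)
Lemma K0_class_finite_diff n (P Q : idem A n.+1) :
  mx_finite (idem_mx P - idem_mx Q) -> exists z : int, K0_class P - K0_class Q = g *~ z.
Proof.
move=> [r [a [c PQ]]].
have [P1 [k [P1E ->]]] := K0_split_functionals P c.
have [Q1 [l [Q1E ->]]] := K0_split_functionals Q c.
have PQy m (y : 'M[A]_(n.+1, m)) : E r *m c *m y = 0 -> P *m y = Q *m y.
  move=> cy; apply/eqP; rewrite -subr_eq0 -mulmxBl PQ -!mulmxA.
  by rewrite (mulmxA _ c) cy mulmx0.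
have Q1P1 : Q1 *m P1 = P1.
  have [PP1 cP1] := (P1E _ _).1 (idemE P1).
  by apply/Q1E; split=> //; rewrite -PQy.
have P1Q1 : P1 *m Q1 = Q1.
  have [QQ1 cQ1] := (Q1E _ _).1 (idemE Q1).
  by apply/P1E; split=> //; rewrite PQy.
have -> : K0_class P1 = K0_class Q1.
  by apply: eq_K0_class; exists (Q1 : 'M_n.+1), (P1 : 'M_n.+1).
exists (k%:Z - l%:Z); rewrite opprD addrACA subrr add0r.
by rewrite mulrzBr -!pmulrn.
Qed.

Lemma K0_class_sub_scalar n (P sP : idem A n.+1) :
  sP = map_mx (iota \o sigma) P :> 'M_n.+1 ->
  exists z : int, K0_class P - K0_class sP = g *~ z.
Proof.
move=> sPE; pose U : 'M[A]_n.+1 := P *m sP + (1%:M - idem_mx P) *m (1%:M - idem_mx sP).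
have PU : P *m U = P *m sP.
  by rewrite mulmxDr !mulmxA (mulmxBr (idem_mx P)) mulmx1 idemE subrr mul0mx addr0.
have UsP : U *m sP = P *m sP.
  by rewrite mulmxDl -!mulmxA (mulmxBl _ (idem_mx sP)) mul1mx !idemE subrr mulmx0 addr0.
have ssP : map_mx sigma sP = map_mx sigma P.
  by rewrite sPE; apply/matrixP => i j; rewrite !mxE /= sigmaK.
(* Both [P] and [sP] have the same scalar matrix [s], an idempotent, and
   [s s + (1 - s)(1 - s) = 1]. *)
have [G Gf [V' [VV' V'V]]] : exists2 G, mx_finite G & mx_unit (U + G).
  apply: fredholm_mx; rewrite map_mxD !map_mxM !map_mxB map_mx1 ssP.
  rewrite mulmxBr mulmx1 mulmxBl mul1mx -map_mxM idemE subrr subr0.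
  by rewrite addrC subrK.
set V := U + G in VV' V'V.
have Q_idem : (V *m sP *m V') *m (V *m sP *m V') == V *m sP *m V'.
  apply/eqP; rewrite !mulmxA -(mulmxA _ V' V) V'V mulmx1.
  by rewrite -(mulmxA V sP sP) idemE.
rewrite (@eq_K0_class _ _ sP (Idem Q_idem)).
  apply: K0_class_finite_diff => /=.
  (* In [P V - V sP] the contributions of [U] cancel because [P U = U sP]; only terms containing [G]
     remain. *)
  have -> : idem_mx P - V *m sP *m V' = (P *m G - G *m sP) *m V'.
    rewrite -[X in X - _]mulmx1 -VV' mulmxA -mulmxBl; congr (_ *m _).
    by rewrite mulmxDr mulmxDl PU UsP opprD addrACA subrr add0r.
  apply/mx_finiteMr/mx_finiteD; first exact: mx_finiteMl.
  exact/mx_finiteN/mx_finiteMr.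
exists (sP *m V'), (V *m sP) => /=; split; last first.
  by rewrite !mulmxA -(mulmxA V sP sP) idemE.
by rewrite !mulmxA -(mulmxA _ V') V'V mulmx1 idemE.
Qed.

Fact idem_compl_subproof n (P : idem A n) :
  (1%:M - idem_mx P) *m (1%:M - idem_mx P) == 1%:M - idem_mx P :> 'M_n.
Proof. by rewrite mulmxBr mulmx1 mulmxBl mul1mx idemE subrr subr0. Qed.

Definition idem_compl n (P : idem A n) : idem A n := Idem (idem_compl_subproof P).

Fact idem1_subproof n : 1%:M *m 1%:M == 1%:M :> 'M[A]_n.
Proof. by rewrite mulmx1. Qed.

Definition idem1 n : idem A n := Idem (idem1_subproof n).

Lemma idem_sum_compl n (P : idem A n) :
  idem_equiv (idem_sum P (idem_compl P)) (idem1 n).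
Proof.
have PC : P *m idem_compl P = 0 :> 'M_n by rewrite mulmxBr mulmx1 idemE subrr.
have CP : idem_compl P *m P = 0 :> 'M_n by rewrite mulmxBl mul1mx idemE subrr.
exists (col_mx P (idem_compl P)), (row_mx P (idem_compl P)).
rewrite mul_col_row mul_row_col !idemE PC CP; split=> //=.
by rewrite addrC subrK.
Qed.

Lemma K0_class_corner k : K0_class (corner_idem k.+1) = g *+ k.+1.
Proof.
elim: k => [|k IHk]; first by rewrite mulr1n.
rewrite mulrS -IHk K0_classD; congr K0_class.
by apply: val_inj; exact: (scalar_mx_block 1 k.+1).
Qed.

(** Positive multiples come from diagonal copies of [e], whose scalar part is 0. Negative ones come
    from the complement of such a diagonal, whose scalar part is the identity. *)
Lemma K0_corner_mulrz (z : int) : exists n (P sP : idem A n.+1),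
  sP = map_mx (iota \o sigma) P :> 'M_n.+1 /\ g *~ z = K0_class P - K0_class sP.
Proof.
have s0 : (iota \o sigma) 0 = 0 by rewrite /= !rmorph0.
have sE k : map_mx (iota \o sigma) (E k) = 0.
  by apply/matrixP => i j; rewrite !mxE; case: eqP => _;
    rewrite ?mulr1n ?mulr0n //= ?sigma_e rmorph0 ?rmorph0.
case: z => [[|k]|k].
- exists 0, (idem0 A 1), (idem0 A 1); rewrite subrr mulr0z; split=> //.
  by apply/matrixP => i j; rewrite !mxE s0.
- exists k, (corner_idem k.+1), (idem0 A k.+1); split; first by rewrite sE.
  by rewrite K0_class0 subr0 K0_class_corner.
exists k, (idem_compl (corner_idem k.+1)), (idem1 k.+1); split.
  apply/matrixP => i j; have /matrixP/(_ i j) := sE k.+1.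
  rewrite [LHS]mxE [X in _ = X -> _]mxE /= => sEij.
  rewrite [RHS]mxE /= !mxE rmorphB rmorphB /=.
  move: sEij; rewrite mxE => ->; rewrite subr0.
  by case: eqP => _; rewrite ?mulr1n ?mulr0n ?rmorph1 ?rmorph0.
rewrite NegzE mulrNz -pmulrn -K0_class_corner.
rewrite -(eq_K0_class (idem_sum_compl (corner_idem k.+1))) -K0_classD.
by rewrite opprD addrCA subrr addr0.
Qed.

Lemma K0_corner_neq0 k : g *+ k.+1 <> 0.
Proof.
rewrite -K0_class_corner => /eq_grothP[] /=.
elim/idem_classW=> n K; rewrite !addr0 !add0r => EK.
(* Adding the complement of [K] to both sides replaces the arbitrary cancelling idempotent by an
   identity matrix. *)
have {}EK : idem_class (idem_sum (corner_idem k.+1) (idem1 n.+1)) =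
    idem_class (idem1 n.+1).
  have /eq_idem_class K1 := idem_sum_compl K.
  rewrite -(idem_class_addE _ (idem1 n.+1)) -K1 -(idem_class_addE K).
  by rewrite idem_class_addA; congr (idem_class_add _ _); exact: EK.
have [R [T [RT TR]]] :
    idem_equiv (idem_sum (corner_idem k.+1) (idem1 n.+1)) (idem1 n.+1).
  exact/eq_idem_class.
move: RT TR; rewrite -[R]vsubmxK -[T]hsubmxK mul_col_row mul_row_col /=.
set R1 := usubmx R; set R2 := dsubmx R; set T1 := lsubmx T; set T2 := rsubmx T.
move=> /eq_block_mx[ER1T1 _ R2T1 R2T2] TR.
pose S := map_mx sigma R2.
have SS : S *m map_mx sigma T2 = 1%:M by rewrite -map_mxM -R2T2 map_mx1.
(* The scalar part of [R2] is a square matrix over a field with right inverse [sigma T2], hence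
   invertible; multiplying by the lifted inverse [S'] gives [R2] the scalar part 1. *)
pose S' := map_mx iota (map_mx sigma T2).
have SS' : map_mx iota S *m S' = 1%:M by rewrite -map_mxM SS map_mx1.
have S'S : S' *m map_mx iota S = 1%:M.
  by rewrite -map_mxM (mulmx1C SS) map_mx1.
have [|G Gf Gu] := @fredholm_mx _ (S' *m R2).
  rewrite map_mxM (_ : map_mx sigma S' = map_mx sigma T2); first exact: mulmx1C.
  by apply/matrixP => i j; rewrite !mxE sigmaK.
(* [R2] is a finite perturbation of a unit, so its right inverse [T2] is two-sided. Then [T R = 1]
   leaves [T1 R1 = 0], and [E = E E = R1 (T1 R1) T1] vanishes. *)
have T2R2 : T2 *m R2 = 1%:M.
  have R2E : R2 = map_mx iota S *m (S' *m R2 + G) + - (map_mx iota S *m G).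
    by rewrite mulmxDr mulmxA SS' mul1mx addrK.
  rewrite [R2]R2E; apply: right_inverse_unit.
  - by apply: mx_unitM => //; exists S'.
  - exact/mx_finiteN/mx_finiteMl.
  - by rewrite -R2E -R2T2.
have T1R1 : T1 *m R1 = 0.
  by apply: (addIr (T2 *m R2)); rewrite -TR add0r T2R2.
have : E k.+1 = 0.
  by rewrite -EE [E _]ER1T1 mulmxA -(mulmxA R1) T1R1 mulmx0 mul0mx.
move=> /matrixP/(_ 0 0); rewrite !mxE eqxx => e0.
by move: e_neq0; rewrite -[e]mulr1n e0 eqxx.
Qed.

End Corner.

(** * The complex Hahn-Banach theorem *)

Section RealNorm.
Variables (R : realType) (X : normedModType R[i]).
Implicit Types (x y : X) (a : R[i]) (r : R).

(** Norms over [R[i]] take values in [R[i]]; passing to real parts makes the order and the suprema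
    of [R] available. *)
Definition cabs a : R := complex.Re `|a|.
Definition rnorm x : R := complex.Re `|x|.

Lemma cabsE a : (cabs a)%:C = `|a|.
Proof. by apply: RRe_real; exact: normr_real. Qed.

Lemma rnormE x : (rnorm x)%:C = `|x|.
Proof. by apply: RRe_real; exact: normr_real. Qed.

Lemma cabs_ge0 a : 0 <= cabs a.
Proof. by rewrite -lecR cabsE normr_ge0. Qed.

Lemma cabsM a b : cabs (a * b) = cabs a * cabs b.
Proof. by apply: complexI; rewrite rmorphM /= !cabsE normrM. Qed.

Lemma cabs_eq0 a : cabs a = 0 -> a = 0.
Proof. by move=> a0; apply/eqP; rewrite -normr_eq0 -cabsE a0. Qed.

Lemma cabs0 : cabs 0 = 0.
Proof. by apply: complexI; rewrite cabsE normr0. Qed.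

Lemma cabsV a : cabs a^-1 = (cabs a)^-1.
Proof. by apply: complexI; rewrite fmorphV /= !cabsE normfV. Qed.

Lemma cabs_real r : cabs r%:C = `|r|.
Proof. by rewrite /cabs normc_def /= expr0n addr0 sqrtr_sqr. Qed.

Lemma Re_le_cabs a : complex.Re a <= cabs a.
Proof.
rewrite /cabs normc_def /= (le_trans (ler_norm _))// -sqrtr_sqr ler_wsqrtr//.
by rewrite lerDl sqr_ge0.
Qed.

Lemma rnorm_ge0 x : 0 <= rnorm x.
Proof. by rewrite -lecR rnormE normr_ge0. Qed.

Lemma rnorm_eq0 x : rnorm x = 0 -> x = 0.
Proof. by move=> x0; apply/eqP; rewrite -normr_eq0 -rnormE x0. Qed.

Lemma rnorm_gt0 x : x != 0 -> 0 < rnorm x.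
Proof.
move=> x0; rewrite lt_neqAle rnorm_ge0 andbT eq_sym.
by apply: contraNneq x0 => /rnorm_eq0->.
Qed.

Lemma rnorm0 : rnorm 0 = 0.
Proof. by apply: complexI; rewrite rnormE normr0. Qed.

Lemma rnormD x y : rnorm (x + y) <= rnorm x + rnorm y.
Proof. by rewrite -lecR rmorphD /= !rnormE ler_normD. Qed.

Lemma rnormN x : rnorm (- x) = rnorm x.
Proof. by apply: complexI; rewrite !rnormE normrN. Qed.

Lemma rnormB x y : rnorm (x - y) <= rnorm x + rnorm y.
Proof. by rewrite -(rnormN y) rnormD. Qed.

Lemma rnormBC x y : rnorm (x - y) = rnorm (y - x).
Proof. by rewrite -rnormN opprB. Qed.

Lemma rnorm_triangle x y : rnorm x - rnorm y <= rnorm (x - y).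
Proof. by rewrite lerBlDr (le_trans _ (rnormD _ _))// subrK. Qed.

Lemma rnormZ a x : rnorm (a *: x) = cabs a * rnorm x.
Proof. by apply: complexI; rewrite rmorphM /= !rnormE cabsE normrZ. Qed.

End RealNorm.

(** * Minimal sublinear functionals *)

Section SublinearFunctionals.
Variables (R : realType) (X : lmodType R[i]).
Implicit Types (p q u : X -> R) (x y : X) (r t : R).

Definition sublinear p :=
  (forall x y, p (x + y) <= p x + p y) /\
  (forall r x, 0 < r -> p (r%:C *: x) = r * p x).

Lemma sublinear0 p : sublinear p -> p 0 = 0.
Proof.
by move=> [_ /(_ 2 0 (ltr0n _ 2))]; rewrite scaler0; lra.
Qed.

Lemma sublinear_ge p x : sublinear p -> - p (- x) <= p x.
Proof.
move=> ps; have := ps.1 x (- x); rewrite subrr sublinear0//.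
lra.
Qed.

Lemma sublinear_scale_ge0 p t x : sublinear p -> 0 <= t ->
  p (t%:C *: x) = t * p x.
Proof.
move=> ps; rewrite le_eqVlt => /predU1P[<-|]; last exact: ps.2.
by rewrite scale0r mul0r sublinear0.
Qed.

(* The largest sublinear functional below q whose value at - y is at
   most - q y. *)
Definition sublinear_shift q y x : R :=
  inf [set q (x + t%:C *: y) - t * q y | t in [set t | 0 <= t]].

Section Shift.
Variables (q : X -> R) (y : X).
Hypothesis qs : sublinear q.

Let shift_lb x : lbound
  [set q (x + t%:C *: y) - t * q y | t in [set t : R | 0 <= t]] (- q (- x)).
Proof.
move=> _ [t /= t0 <-]; have := qs.1 (x + t%:C *: y) (- x).
rewrite addrAC subrr add0r sublinear_scale_ge0//; lra.
Qed.

Lemma shift_le x t : 0 <= t ->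
  sublinear_shift q y x <= q (x + t%:C *: y) - t * q y.
Proof. by move=> t0; apply: ge_inf; [exists (- q (- x)); exact: shift_lb | exists t]. Qed.

Lemma le_shift x r : (forall t, 0 <= t -> r <= q (x + t%:C *: y) - t * q y) ->
  r <= sublinear_shift q y x.
Proof.
move=> h; apply: lb_le_inf; first by exists (q (x + 0%:C *: y) - 0 * q y), 0 => /=.
by move=> _ [t /= t0 <-]; exact: h.
Qed.

Lemma shift_sublinear : sublinear (sublinear_shift q y).
Proof.
split=> [x x'|].
  rewrite -lerBlDr; apply: le_shift => s s0; rewrite lerBlDr -lerBlDl.
  apply: le_shift => t t0; rewrite lerBlDl.
  have := @shift_le (x + x') (s + t) (addr_ge0 s0 t0).
  have := qs.1 (x + s%:C *: y) (x' + t%:C *: y).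
  rewrite addrACA -scalerDl -rmorphD /=; lra.
have Zle r x : 0 < r -> sublinear_shift q y (r%:C *: x) <= r * sublinear_shift q y x.
  move=> r0; rewrite -ler_pdivrMl//; apply: le_shift => t t0.
  rewrite ler_pdivrMl// (le_trans (@shift_le _ (r * t) _)) ?mulr_ge0 ?(ltW r0)//.
  by rewrite rmorphM /= -scalerA -scalerDr qs.2// mulrBr mulrA.
move=> r x r0; apply/eqP; rewrite eq_le Zle//=.
have := @Zle r^-1 (r%:C *: x); rewrite invr_gt0 => /(_ r0).
rewrite scalerA -rmorphM /= mulVf ?gt_eqF// scale1r ler_pdivlMl//.
Qed.

Lemma shift_le_id x : sublinear_shift q y x <= q x.
Proof.
by have := @shift_le x 0 (lexx 0); rewrite scale0r addr0 mul0r subr0.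
Qed.

Lemma shiftN : sublinear_shift q y (- y) <= - q y.
Proof.
have := @shift_le (- y) 1 ler01; rewrite scale1r addNr sublinear0// mul1r.
by rewrite sub0r.
Qed.

End Shift.

(** Zorn's lemma for the reversed pointwise order. The pointwise infimum of a nonempty chain is
    finite, since [- p (- x)] bounds it below, and it is subadditive because the smaller of two
    members of the chain is smaller at both points. *)
Lemma minimal_sublinear p : sublinear p ->
  exists2 q, sublinear q /\ (forall x, q x <= p x) &
    forall q', sublinear q' -> (forall x, q' x <= q x) -> q' = q.
Proof.
move=> ps; pose T := {q : X -> R | sublinear q /\ forall x, q x <= p x}.
pose rel (q q' : T) := `[< forall x, sval q' x <= sval q x >].
have [|||A Atot|[q [qs qp]] qmin] := @Zorn T rel.
- by move=> q; apply/asboolP.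
- move=> q1 q2 q3 /asboolP h1 /asboolP h2; apply/asboolP => x.
  exact: le_trans (h2 x) (h1 x).
- move=> [q1 h1] [q2 h2] /asboolP /= h12 /asboolP /= h21.
  by apply/eq_exist/funext => x; apply/eqP; rewrite eq_le h21 h12.
- have [->|/set0P[q0 Aq0]] := eqVneq A set0.
    by exists (exist _ p (conj ps (fun x => lexx _))).
  pose B x := [set sval (q : T) x | q in A]; pose m x := inf (B x).
  have B0 x : nonempty (B x) by exists (sval q0 x), q0.
  have mle x (q : T) : A q -> m x <= sval q x.
    move=> Aq; apply: ge_inf; last by exists q.
    exists (- p (- x)) => _ [[q' [qs' qp']] Aq' <-] /=.
    by have := sublinear_ge x qs'; have := qp' (- x); lra.
  have lem x r : (forall q : T, A q -> r <= sval q x) -> r <= m x.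
    by move=> h; apply: lb_le_inf => // _ [q Aq <-]; exact: h.
  have ms : sublinear m.
    split=> [x y|].
      rewrite -lerBlDr; apply: (lem x) => q1 Aq1; rewrite lerBlDr -lerBlDl.
      apply: (lem y) => q2 Aq2; rewrite lerBlDl.
      case: (Atot _ _ Aq1 Aq2) => /asboolP le12.
        have := mle (x + y) _ Aq2; have := (svalP q2).1.1 x y; have := le12 x.
        lra.
      have := mle (x + y) _ Aq1; have := (svalP q1).1.1 x y; have := le12 y.
      lra.
    have Zle r x : 0 < r -> m (r%:C *: x) <= r * m x.
      move=> r0; rewrite -ler_pdivrMl//; apply: lem => q Aq.
      by rewrite ler_pdivrMl// (le_trans (mle _ _ Aq))// (svalP q).1.2.
    move=> r x r0; apply/eqP; rewrite eq_le Zle//=.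
    have := @Zle r^-1 (r%:C *: x); rewrite invr_gt0 => /(_ r0).
    by rewrite scalerA -rmorphM /= mulVf ?gt_eqF// scale1r ler_pdivlMl.
  have mp x : m x <= p x := le_trans (mle x _ Aq0) ((svalP q0).2 x).
  exists (exist _ m (conj ms mp)) => q Aq; apply/asboolP => x.
  exact: mle.
exists q => // q' qs' qq'.
have qp' x : q' x <= p x := le_trans (qq' x) (qp x).
have /(_ _)/(congr1 sval)/= := qmin (exist _ q' (conj qs' qp')).
by apply; apply/asboolP.
Qed.

(** By minimality [q] equals its shift along any [y]; the parameter [t = 1] in the infimum gives
    [q x + q y <= q (x + y)]. Additivity then yields the negative scalars. *)
Lemma minimal_sublinear_linear q : sublinear q ->
  (forall q', sublinear q' -> (forall x, q' x <= q x) -> q' = q) ->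
  (forall x y, q (x + y) = q x + q y) /\ (forall r x, q (r%:C *: x) = r * q x).
Proof.
move=> qs qmin.
have qD x y : q (x + y) = q x + q y.
  apply/eqP; rewrite eq_le qs.1 /=.
  have sq : sublinear_shift q y = q.
    by apply: qmin => [|z]; [exact: shift_sublinear|exact: shift_le_id].
  have := @shift_le q y qs x 1 ler01; rewrite sq scale1r; lra.
split=> // r x; have [r0|r0] := leP 0 r; first exact: sublinear_scale_ge0.
have := qD (r%:C *: x) ((- r)%:C *: x).
rewrite -scalerDl -rmorphD /= subrr scale0r sublinear0//.
rewrite [q ((- r)%:C *: _)]qs.2; last lra.
lra.
Qed.

End SublinearFunctionals.

(** * Bounded functionals and the norming functional of a vector *)

Section HahnBanach.
Variable R : realType.

Record functional (X : normedModType R[i]) := Functional {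
  functional_fun :> X -> R[i];
  functional_linear : forall a x y,
    functional_fun (a *: x + y) = a * functional_fun x + functional_fun y;
  functional_bounded :
    exists M, forall x, cabs (functional_fun x) <= M * rnorm x }.

Variable X : normedModType R[i].
Implicit Types (f : functional X) (x y : X).

Lemma functional0 f : f 0 = 0.
Proof.
by have := functional_linear f (-1) 0 0; rewrite scaler0 add0r mulN1r addNr.
Qed.

Lemma functionalD f x y : f (x + y) = f x + f y.
Proof. by have := functional_linear f 1 x y; rewrite scale1r mul1r. Qed.

Lemma functionalZ f a x : f (a *: x) = a * f x.
Proof. by have := functional_linear f a x 0; rewrite functional0 !addr0. Qed.

Lemma functionalN f x : f (- x) = - f x.
Proof. by rewrite -scaleN1r functionalZ mulN1r. Qed.

Lemma functional_sum f I (s : seq I) (P : pred I) (F : I -> X) :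
  f (\sum_(i <- s | P i) F i) = \sum_(i <- s | P i) f (F i).
Proof.
by apply: (big_morph f); [exact: functionalD|exact: functional0].
Qed.

Lemma hahn_banach (x0 : X) : x0 != 0 ->
  exists f : functional X, f x0 = 1 /\ forall x, cabs (f x) * rnorm x0 <= rnorm x.
Proof.
move=> x00; have nx0 := rnorm_gt0 x00.
have ns : sublinear (@rnorm R X).
  split=> [x y|r x r0]; first exact: rnormD.
  by rewrite rnormZ cabs_real gtr0_norm.
(* Minimizing below the shift of the norm along [x0], rather than below the norm itself, forces
   [u x0] to be at least the norm of [x0]. *)
have [u [us up] umin] := minimal_sublinear (shift_sublinear x0 ns).
have [uD uZ] := minimal_sublinear_linear us umin.
have un x : u x <= rnorm x := le_trans (up x) (shift_le_id x0 ns x).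
have uN x : u (- x) = - u x by have := uZ (-1) x; rewrite rmorphN rmorph1 scaleN1r mulN1r.
have ux0 : rnorm x0 <= u x0.
  by have := le_trans (up (- x0)) (shiftN x0 ns); rewrite uN lerN2.
(* The complex-linear functional whose real part is [u]. *)
pose g x : R[i] := u x +i* - u ('i *: x).
have gD x y : g (x + y) = g x + g y.
  by rewrite /g scalerDr !uD opprD.
have gZ a x : g (a *: x) = a * g x.
  case: a => a b; have -> : (a +i* b) *: x = a%:C *: x + b%:C *: ('i *: x).
    by rewrite scalerA -scalerDl; congr (_ *: _); simpc.
  rewrite /g scalerDr !scalerA !(mulrC 'i) -!scalerA (scalerA 'i 'i) !uD !uZ.
  have -> : 'i * 'i = -1 :> R[i] by rewrite -expr2 sqr_i.
  rewrite scaleN1r uN; simpc; congr (_ +i* _); lra.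
have gn x : cabs (g x) <= rnorm x.
  have [->|gx0] := eqVneq (g x) 0; first by rewrite cabs0 rnorm_ge0.
  (* A rotation of modulus 1 making [g (th *: x)] real and equal to the modulus of [g x], so that
     the bound on [u] carries over to [g]. *)
  pose th := (cabs (g x))%:C / g x.
  have cg0 : cabs (g x) != 0 by apply: contra_neq gx0; exact: cabs_eq0.
  have cth : cabs th = 1.
    by rewrite cabsM cabsV cabs_real ger0_norm ?cabs_ge0// mulfV.
  have : g (th *: x) = (cabs (g x))%:C by rewrite gZ /th mulrVK ?unitfE.
  move=> /(congr1 (@complex.Re R)) /= <-.
  by rewrite (le_trans (un _))// rnormZ cth mul1r.
have gx0 : rnorm x0 <= cabs (g x0) by rewrite (le_trans ux0)// (Re_le_cabs (g x0)).
have cg0 : 0 < cabs (g x0) by exact: lt_le_trans gx0.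
have g0 : g x0 != 0 by apply: contraTneq cg0 => ->; rewrite cabs0 ltxx.
have fl a x y : (g x0)^-1 * g (a *: x + y) = a * ((g x0)^-1 * g x) + (g x0)^-1 * g y.
  by rewrite gD gZ mulrDr mulrCA.
have fb x : cabs ((g x0)^-1 * g x) * rnorm x0 <= rnorm x.
  rewrite cabsM cabsV -mulrA mulrC ler_pdivrMr//.
  by rewrite ler_pM ?cabs_ge0 ?rnorm_ge0.
have fb' : exists M, forall x, cabs ((g x0)^-1 * g x) <= M * rnorm x.
  by exists (rnorm x0)^-1 => x; rewrite ler_pdivlMl// mulrC.
by exists (Functional fl fb') => /=; rewrite mulVf.
Qed.

End HahnBanach.

(** * Finite rank perturbations of invertible operators *)

Section Operators.
Variable R : realType.

Lemma geometric_small (d K e : R) : 0 <= d < 1 -> 0 < e ->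
  exists n, d ^+ n * K < e.
Proof.
move=> /andP[d0 d1] e0; have K0 : 0 < `|K| + 1 by rewrite ltr_wpDl.
have /cvgr0Pnorm_lt/(_ (e / (`|K| + 1)) (divr_gt0 e0 K0)) :
    (GRing.exp d : nat -> R) @ \oo --> 0 by apply: cvg_expr; rewrite ger0_norm.
move=> [n _ /(_ n (leqnn n))] /=; rewrite ger0_norm ?exprn_ge0// => dn.
exists n; apply: le_lt_trans (_ : d ^+ n * (`|K| + 1) < e); last by rewrite -ltr_pdivlMr.
by rewrite ler_wpM2l ?exprn_ge0//; have := ler_norm K; lra.
Qed.

Lemma rnorm_complete (X : completeNormedModType R[i]) (u : nat -> X) :
  (forall e, 0 < e -> exists N, forall n m, (N <= n)%N -> (N <= m)%N ->
    rnorm (u n - u m) < e) ->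
  exists l, forall e, 0 < e ->
    exists N, forall n, (N <= n)%N -> rnorm (u n - l) < e.
Proof.
move=> uC; have : cvg (u @ \oo).
  apply: cauchy_cvg; apply: cauchy_exP => e e0; rewrite /fmapE -ball_normE /ball_.
  have eE : (complex.Re e)%:C = e by apply: RRe_real; exact: gtr0_real.
  have [|N uN] := uC (complex.Re e); first by rewrite -ltcR eE.
  exists (u N), N => // n /= Nn.
  by rewrite -eE -rnormE ltcR; exact: uN.
rewrite cvg_ex => -[l ul]; exists l => e e0.
have e0' : 0 < e%:C by rewrite ltcR.
have /cvgrPdist_lt/(_ _ e0')[N _ uN] := ul.
exists N => n Nn; rewrite rnormBC -ltcR rnormE; exact: uN.
Qed.

Lemma bop_bounded (X Y : normedModType R[i]) (T : bop X Y) :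
  exists2 M, 0 < M & forall x, rnorm (T x) <= M * rnorm x.
Proof.
exists (opnorm T + 1) => [|x]; first by have := opnorm_ge0 T; lra.
have := opnorm_ub T x; rewrite -!rnormE -rmorphM lecR => /le_trans; apply.
by rewrite ler_wpM2r ?rnorm_ge0// lerDl.
Qed.

Lemma bounded_is_bop (X Y : normedModType R[i]) (g : X -> Y) :
  linear g -> (exists M, forall x, rnorm (g x) <= M * rnorm x) ->
  g \in @is_bop _ X Y.
Proof.
move=> gl [M gM].
pose G : {linear X -> Y} := HB.pack g (GRing.isLinear.Build _ _ _ _ g gl).
apply/asboolP; split=> //; apply: (@bounded_linear_continuous _ _ _ G).
apply/bounded_funP => r; exists ((`|M|)%:C * r) => x xr /=.
apply: le_trans (_ : (`|M|)%:C * `|x| <= _); last first.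
  by rewrite ler_wpM2l// -[0]/(0%:C) lecR.
rewrite -!rnormE -rmorphM lecR (le_trans (gM x))// ler_wpM2r ?rnorm_ge0//.
exact: ler_norm.
Qed.

Lemma bopB (X Y : normedModType R[i]) (T : bop X Y) x y : T (x - y) = T x - T y.
Proof. exact: linearB. Qed.

Lemma bopZ (X Y : normedModType R[i]) (T : bop X Y) a x : T (a *: x) = a *: T x.
Proof. exact: linearZ. Qed.

(** * Rank one operators, operators bounded below, Neumann's lemma *)

Section RankOne.
Variable X : completeNormedModType R[i].
Implicit Types (f g : functional X) (T U V D : bop X X) (x y z : X).

Fact rank1_subproof y f : (fun x => f x *: y) \in @is_bop _ X X.
Proof.
apply: bounded_is_bop => [a u v|]; first by rewrite functional_linear scalerDl scalerA.
have [M fM] := functional_bounded f; exists (M * rnorm y) => x.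
by rewrite rnormZ mulrAC ler_wpM2r ?rnorm_ge0.
Qed.

Definition rank1 y f : bop X X := Bop (rank1_subproof y f).

Fact functional_comp_linear f T a x y :
  f (T (a *: x + y)) = a * f (T x) + f (T y).
Proof. by rewrite linearP functional_linear. Qed.

Fact functional_comp_bounded f T :
  exists M, forall x, cabs (f (T x)) <= M * rnorm x.
Proof.
have [M fM] := functional_bounded f; have [N N0 TN] := bop_bounded T.
exists (`|M| * N) => x; rewrite (le_trans (fM _))// -mulrA.
rewrite (le_trans (_ : _ <= `|M| * rnorm (T x)))//.
  by rewrite ler_wpM2r ?rnorm_ge0// ler_norm.
by rewrite ler_wpM2l.
Qed.

Definition functional_comp f T : functional X :=
  Functional (functional_comp_linear f T) (functional_comp_bounded f T).

Lemma rank1Mr y f T : rank1 y f * T = rank1 y (functional_comp f T).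
Proof. exact/bopP. Qed.

Lemma rank1Ml y f T : T * rank1 y f = rank1 (T y) f.
Proof. by apply/bopP => x; exact: linearZ. Qed.

Lemma rank1M y f z g : rank1 y f * rank1 z g = f z *: rank1 y g.
Proof.
rewrite rank1Ml; apply/bopP => x.
rewrite -[LHS]/(g x *: (f z *: y)) -[RHS]/(f z *: (g x *: y)).
by rewrite !scalerA mulrC.
Qed.

Definition op_unit T := exists V, T * V = 1 /\ V * T = 1.

Lemma op_unitM T U : op_unit T -> op_unit U -> op_unit (T * U).
Proof.
move=> [T' [TT' T'T]] [U' [UU' U'U]]; exists (U' * T'); split.
  by rewrite mulrA -(mulrA T) UU' mulr1.
by rewrite mulrA -(mulrA U') T'T mulr1.
Qed.

(** A closed subspace of finite codimension, given by a list of functionals so that inductions can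
    drop them one at a time. *)
Fixpoint kers (L : seq (functional X)) : set X :=
  if L is f :: L' then [set x | f x = 0 /\ kers L' x] else setT.

Lemma kers_linear L a x y : kers L x -> kers L y -> kers L (a *: x + y).
Proof.
elim: L => //= f L IH [fx Lx] [fy Ly]; split; last exact: IH.
by rewrite functional_linear fx fy mulr0 addr0.
Qed.

Lemma kersZ L a x : kers L x -> kers L (a *: x).
Proof.
have L0 : kers L 0 by elim: L => //= f L IH; split=> //; exact: functional0.
by move=> Lx; rewrite -[_ *: _]addr0; exact: kers_linear.
Qed.

Lemma kersB L x y : kers L x -> kers L y -> kers L (x - y).
Proof. by move=> Lx Ly; rewrite addrC -scaleN1r; exact: kers_linear. Qed.

Lemma kers_closed L l :
  (forall e, 0 < e -> exists2 x, kers L x & rnorm (x - l) < e) -> kers L l.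
Proof.
elim: L => //= f L IH h; split; last first.
  by apply: IH => e /h[x [_ Lx] xl]; exists x.
have [M fM] := functional_bounded f.
apply: contrapT => /eqP fl0; have : 0 < cabs (f l).
  rewrite lt_neqAle cabs_ge0 andbT eq_sym.
  by apply: contra_neq fl0; exact: cabs_eq0.
move=> fl; have M0 : 0 < `|M| + 1 by rewrite ltr_wpDl.
have [x [fx _]] := h _ (divr_gt0 fl M0); rewrite ltr_pdivlMr// => xl.
have := fM (x - l); rewrite functionalD functionalN fx add0r -mulN1r cabsM.
have -> : cabs (-1 : R[i]) = 1.
  by rewrite -[-1]/(- 1%:C) -rmorphN cabs_real normrN1.
have : M * rnorm (x - l) <= (`|M| + 1) * rnorm (x - l).
  by rewrite ler_wpM2r ?rnorm_ge0//; have := ler_norm M; lra.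
lra.
Qed.

Definition bounded_below L T (c : R) :=
  forall x, kers L x -> c * rnorm x <= rnorm (T x).

Lemma bounded_below_inj L T c x y : 0 < c -> bounded_below L T c ->
  kers L x -> kers L y -> T x = T y -> x = y.
Proof.
move=> c0 cT Lx Ly Txy; have := cT _ (kersB Lx Ly).
rewrite bopB Txy subrr rnorm0 pmulr_rle0// => xy.
apply/eqP; rewrite -subr_eq0; apply/eqP/rnorm_eq0/eqP.
by rewrite eq_le xy rnorm_ge0.
Qed.

(** The lower bound makes approximate preimages of [y] a Cauchy sequence; its limit stays in the
    closed subspace [kers L] and is mapped to [y] by continuity. *)
Lemma bounded_below_closed_range L T c y : 0 < c -> bounded_below L T c ->
  (forall e, 0 < e -> exists2 x, kers L x & rnorm (T x - y) < e) ->
  exists2 x, kers L x & T x = y.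
Proof.
move=> c0 cT yT.
have inv0 n : 0 < (n.+1%:R : R)^-1 by rewrite invr_gt0.
have /choice[u uP] n : exists x, kers L x /\ rnorm (T x - y) < n.+1%:R^-1.
  by have [x] := yT _ (inv0 n); exists x.
have small e : 0 < e -> exists N, forall n, (N <= n)%N -> rnorm (T (u n) - y) < e.
  move=> e0; exists (Num.truncn e^-1) => n Nn; apply: lt_le_trans (uP n).2 _.
  rewrite invf_ple ?posrE// (le_trans (ltW (truncnS_gt _)))//.
  by rewrite ler_nat ltnS.
have [|l ul] := rnorm_complete (u := u).
  move=> e e0; have [|N uN] := small (c * e / 2); first by rewrite divr_gt0 ?mulr_gt0.
  exists N => n m Nn Nm; have := cT _ (kersB (uP n).1 (uP m).1).
  rewrite bopB.
  have -> : T (u n) - T (u m) = (T (u n) - y) - (T (u m) - y).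
    by rewrite opprB addrA subrK.
  have := rnormB (T (u n) - y) (T (u m) - y); have := uN _ Nn; have := uN _ Nm.
  by move=> h1 h2 h3 h4; rewrite -(ltr_pM2l c0); lra.
exists l.
  apply: kers_closed => e e0; have [N uN] := ul e e0; exists (u N) => //.
    exact: (uP N).1.
  exact: uN.
have [M M0 TM] := bop_bounded T.
apply/eqP; rewrite -subr_eq0; apply: contraT => /rnorm_gt0 d0.
set d := rnorm _ in d0.
have [|N uN] := small (d / 2); first by rewrite divr_gt0.
have [|N' uN'] := ul (d / 2 / M); first by rewrite !divr_gt0.
have := uN _ (leq_maxl N N'); have := uN' _ (leq_maxr N N').
set n := maxn N N'; rewrite ltr_pdivlMr// mulrC => h1 h2.
have lE : T l - y = T (l - u n) + (T (u n) - y) by rewrite bopB addrA subrK.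
have := rnormD (T (l - u n)) (T (u n) - y); rewrite -lE -/d.
have := TM (l - u n); rewrite (rnormBC l); lra.
Qed.

Lemma bounded_below_inverse L T c : 0 < c -> bounded_below L T c ->
  (forall y, exists2 x, kers L x & T x = y) ->
  exists V, T * V = 1 /\ forall y, kers L (V y).
Proof.
move=> c0 cT surj.
have /choice[v vP] y : exists x, kers L x /\ T x = y by have [x] := surj y; exists x.
have vl : linear v.
  move=> a x y; apply: (bounded_below_inj c0 cT).
  - exact: (vP _).1.
  - exact: kers_linear (vP x).1 (vP y).1.
  - by rewrite (bop_linear T) !(vP _).2.
have vb : exists M, forall y, rnorm (v y) <= M * rnorm y.
  by exists c^-1 => y; rewrite ler_pdivlMl// (le_trans (cT _ (vP y).1))// (vP y).2.
exists (Bop (bounded_is_bop vl vb)); split; last by move=> y; exact: (vP y).1.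
by apply/bopP => y; exact: (vP y).2.
Qed.

Lemma bounded_below_unit T c : 0 < c -> bounded_below [::] T c ->
  (forall y e, 0 < e -> exists x, rnorm (T x - y) < e) -> op_unit T.
Proof.
move=> c0 cT dense.
have [|V [TV _]] := bounded_below_inverse c0 cT.
  move=> y; apply: (bounded_below_closed_range c0 cT) => e e0.
  by have [x] := dense y e e0; exists x.
exists V; split=> //; apply/bopP => x; apply: (bounded_below_inj c0 cT) => //.
by have /bopP/(_ (T x)) := TV.
Qed.

(** [1 + D] is bounded below by [1 - d], so dense range suffices. The iterates of [x |-> y - D x]
    are approximate solutions: the error at the [n]th one is the difference of two consecutive
    iterates, of norm at most [d^n] times that of [y]. *)
Lemma neumann D (d : R) : 0 <= d < 1 ->
  (forall x, rnorm (D x) <= d * rnorm x) -> op_unit (1 + D).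
Proof.
move=> d01 Dd; have /andP[d0 d1] := d01.
apply: (@bounded_below_unit _ (1 - d)); first by rewrite subr_gt0.
  move=> x _; rewrite -[(1 + D) x]/(x + D x) -[D x]opprK.
  have := rnorm_triangle x (- D x); rewrite rnormN opprK; have := Dd x; lra.
move=> y e e0; pose w n := iter n (fun x => y - D x) 0.
have wS n : w n.+1 = y - D (w n) by [].
have wn n : rnorm (w n.+1 - w n) <= d ^+ n * rnorm y.
  elim: n => [|n IHn]; first by rewrite /w /= linear0 !subr0 expr0 mul1r.
  have -> : w n.+2 - w n.+1 = - D (w n.+1 - w n).
    by rewrite bopB (wS n.+1) [X in _ - X = _]wS !opprB addrC subrKA.
  rewrite rnormN (le_trans (Dd _))// exprS -mulrA.
  by rewrite ler_wpM2l.
have [n dn] := geometric_small (rnorm y) d01 e0.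
exists (w n); rewrite -[(1 + D) _]/(w n + D (w n)).
have -> : w n + D (w n) - y = w n - w n.+1 by rewrite /= opprB addrA.
by rewrite rnormBC (le_lt_trans (wn n)).
Qed.

Lemma op_unit_perturb T D (c d : R) : op_unit T -> bounded_below [::] T c ->
  0 <= d < c -> (forall x, rnorm (D x) <= d * rnorm x) -> op_unit (T + D).
Proof.
move=> Tu cT /andP[d0 dc] Dd; have c0 : 0 < c by lra.
have [V [TV VT]] := Tu.
have -> : T + D = T * (1 + V * D) by rewrite mulrDr mulr1 mulrA TV mul1r.
apply: op_unitM => //; apply: (@neumann _ (d / c)).
  by rewrite divr_ge0 ?(ltW c0)//= ltr_pdivrMr// mul1r.
move=> x; rewrite mulrAC ler_pdivlMr// mulrC.
have := cT (V (D x)) I; rewrite -[T (V (D x))]/((T * V) (D x)) TV.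
by move=> /le_trans; apply; exact: Dd.
Qed.

Lemma op_unit_bounded_below T : op_unit T ->
  exists2 c, 0 < c & bounded_below [::] T c.
Proof.
move=> [V [_ VT]]; have [M M0 VM] := bop_bounded V.
exists M^-1; first by rewrite invr_gt0.
move=> x _; rewrite ler_pdivrMl//.
by have := VM (T x); rewrite -[V (T x)]/((V * T) x) VT.
Qed.

End RankOne.

Definition bop_scal (X : normedModType R[i]) (z : R[i]) : bop X X :=
  z *: bop_id X.

Lemma bop_scal_zmod (X : normedModType R[i]) : zmod_morphism (@bop_scal X).
Proof. by move=> a b; rewrite /bop_scal scalerBl. Qed.

Lemma bop_scal_monoid (X : normedModType R[i]) : monoid_morphism (@bop_scal X).
Proof.
split=> [|a b]; first exact: scale1r.
by apply/bopP => x; rewrite -[LHS]/((a * b) *: x) -scalerA.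
Qed.

HB.instance Definition _ (X : normedModType R[i]) :=
  GRing.isZmodMorphism.Build R[i] (bop X X) (@bop_scal X) (@bop_scal_zmod X).
HB.instance Definition _ (X : normedModType R[i]) :=
  GRing.isMonoidMorphism.Build R[i] (bop X X) (@bop_scal X) (@bop_scal_monoid X).

Lemma bop_scalC (X : normedModType R[i]) z (a : bop X X) :
  bop_scal X z * a = a * bop_scal X z.
Proof. by apply/bopP => x; rewrite -[RHS]/(a (z *: x)) linearZ. Qed.

(** * Stability of index zero *)

Section Fredholm.
Variables (X : completeNormedModType R[i]) (w : X) (gamma : functional X).
Hypothesis gamma_w : gamma w = 1.
Implicit Types (f g : functional X) (T U V D : bop X X) (x y z : X).

Let e : bop X X := rank1 w gamma.

Lemma corner_rank1_idem : e * e = e.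
Proof. by rewrite rank1M gamma_w scale1r. Qed.

Lemma corner_rank1_neq0 : e != 0.
Proof.
apply/eqP => /bopP/(_ w); rewrite -[LHS]/(gamma w *: w) gamma_w scale1r => w0.
by have /eqP := gamma_w; rewrite w0 functional0 eq_sym oner_eq0.
Qed.

Lemma corner_rank1E T : e * T * e = bop_scal X (gamma (T w)) * e.
Proof. by rewrite rank1Mr rank1M; exact/bopP. Qed.

(* Over 'M_1, so that the results on matrices apply: T is a finite rank
   perturbation of an invertible operator. *)
Definition fredholm0 T :=
  exists2 G : 'M[bop X X]_1, mx_finite e G & mx_unit (T%:M + G).

(** Any rank one operator passes through the fixed [e], which is the form required by
    [mx_finite]. *)
Lemma rank1_factor y f : rank1 y f = rank1 y gamma * e * rank1 w f.
Proof. by rewrite rank1M gamma_w scale1r rank1M gamma_w scale1r. Qed.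

Lemma rank1_finite y f : mx_finite e ((rank1 y f)%:M : 'M_1).
Proof.
exists 1, (rank1 y gamma)%:M, (rank1 w f)%:M.
by rewrite rank1_factor !scalar_mxM.
Qed.

Lemma fredholm0D T y f : fredholm0 (T + rank1 y f) -> fredholm0 T.
Proof.
move=> [G Gf]; rewrite raddfD -addrA => Tu; exists ((rank1 y f)%:M + G) => //.
by apply: mx_finiteD => //; exact: rank1_finite.
Qed.

Lemma rank1N y f : - rank1 y f = rank1 (- y) f.
Proof. by apply/bopP => x; rewrite -[RHS]/(f x *: - y) scalerN. Qed.

Lemma fredholm0Dr T y f : fredholm0 T -> fredholm0 (T + rank1 y f).
Proof.
move=> TF; apply: (@fredholm0D _ (- y) f).
by rewrite -rank1N addrK.
Qed.

Lemma op_unit_mx T : op_unit T <-> mx_unit (T%:M : 'M_1).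
Proof.
split=> [[V [TV VT]]|[V [TV VT]]].
  by exists V%:M; rewrite -!scalar_mxM TV VT.
exists (V 0 0); split.
  by have /matrixP/(_ 0 0) := TV; rewrite mul_scalar_mx !mxE mulr1n.
have /matrixP/(_ 0 0) := VT; rewrite [V]mx11_scalar -scalar_mxM.
by rewrite !mxE !mulr1n.
Qed.

Lemma op_unit_fredholm0 T : op_unit T -> fredholm0 T.
Proof.
move=> /op_unit_mx Tu; exists 0; first exact: mx_finite0.
by rewrite addr0.
Qed.

Lemma fredholm0_inj T : fredholm0 T -> (forall x, T x = 0 -> x = 0) -> op_unit T.
Proof.
move=> [G Gf Gu] Tinj; apply/op_unit_mx.
have -> : T%:M = T%:M + G + - G by rewrite addrK.
apply: (left_regular_unit (@bop_scalC X) corner_rank1_idem corner_rank1_neq0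
  corner_rank1E Gu (mx_finiteN Gf)) => b.
rewrite addrK mul_scalar_mx => /matrixP Tb.
apply/colP => i; rewrite [RHS]mxE; apply/bopP => x; apply: Tinj.
by have := Tb i 0; rewrite !mxE => /bopP/(_ x).
Qed.

Lemma fredholm0_right T V : fredholm0 T -> T * V = 1 -> V * T = 1.
Proof.
move=> [G Gf Gu] TV; have TGE : T%:M = T%:M + G + - G by rewrite addrK.
have : (V%:M : 'M_1) *m T%:M = 1%:M.
  rewrite TGE; apply: (right_inverse_unit (@bop_scalC X) corner_rank1_idem
    corner_rank1_neq0 corner_rank1E Gu (mx_finiteN Gf)).
  by rewrite addrK -scalar_mxM TV.
by rewrite -scalar_mxM => /matrixP/(_ 0 0); rewrite !mxE !mulr1n.
Qed.

Lemma bounded_below_approx T T' (c d : R) : bounded_below [::] T c ->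
  (forall x, rnorm (T' x - T x) <= d * rnorm x) ->
  bounded_below [::] T' (c - d).
Proof.
move=> cT dT x _; have := cT x I; have := dT x.
have := rnorm_triangle (T x) (T x - T' x).
rewrite opprB addrCA subrr addr0 (rnormBC (T x)); lra.
Qed.

(* If T is bounded below on the kernel of the functionals in L, one
   functional f is removed at a time by sending a vector x with f x = 1 to a
   vector y at positive distance from T (kers (f :: L)). When there is no such
   y, the approximants of T are right invertible, hence invertible, which makes
   the right inverse V of T with range in ker f invertible: a contradiction. *)
Lemma fredholm0_closed (L : seq (functional X)) T (c : R) :
  0 < c -> bounded_below L T c ->
  (forall d, 0 < d -> exists2 T', fredholm0 T' &
     forall x, rnorm (T' x - T x) <= d * rnorm x) -> fredholm0 T.
Proof.
elim: L T c => [|f L IH] T c c0 cT lim.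
  (* With an error of [c / 3], [T'] is still bounded below by [2c / 3], which exceeds the size of
     [T - T']. *)
  have [|T' T'F dT] := lim (c / 3); first by rewrite divr_gt0.
  have cT' := bounded_below_approx cT dT.
  have T'u : op_unit T'.
    apply: fredholm0_inj => // x T'x; have := cT' x I.
    rewrite T'x rnorm0 => h; apply: rnorm_eq0; apply/eqP.
    by rewrite eq_le rnorm_ge0 andbT -(@pmulr_rle0 _ (c - c / 3))//; lra.
  apply: op_unit_fredholm0; have -> : T = T' + (T - T') by rewrite addrCA subrr addr0.
  apply: (@op_unit_perturb X _ _ (c - c / 3) (c / 3)) => //.
    by apply/andP; split; lra.
  by move=> x; rewrite rnormBC; exact: dT.
have [[x0 Lx0 /eqP fx0]|none] := pselect (exists2 x, kers L x & f x <> 0); last first.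
  apply: (IH _ c) => // x Lx; apply: cT => /=; split=> //.
  by apply: contrapT => fx; apply: none; exists x.
pose x := (f x0)^-1 *: x0.
have Lx : kers L x by exact: kersZ.
have fx : f x = 1 by rewrite functionalZ mulVf.
have [[y [d d0 yd]]|dense] := pselect (exists y, exists2 d, 0 < d &
    forall z, kers (f :: L) z -> d <= rnorm (T z - y)); last first.
  have [V [TV LV]] : exists V, T * V = 1 /\ forall y, kers (f :: L) (V y).
    apply: (bounded_below_inverse c0 cT) => y.
    apply: (bounded_below_closed_range c0 cT) => d d0.
    apply: contrapT => yd; apply: dense; exists y, d => // z Lz.
    by rewrite leNgt; apply/negP => zd; apply: yd; exists z.
  have [M M0 VM] := bop_bounded V.
  (* This error puts [T' V] within 1/2 of [T V = 1], in reach of Neumann's lemma. *)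
  have [|T' T'F dT] := lim (2^-1 / M); first by rewrite divr_gt0 ?invr_gt0.
  have [U [VU _]] : op_unit (T' * V).
    have -> : T' * V = 1 + (T' * V - 1) by rewrite addrCA subrr addr0.
    apply: (@neumann X _ 2^-1); first by apply/andP; split; lra.
    move=> z; rewrite -TV -[(T' * V - T * V) z]/(T' (V z) - T (V z)).
    rewrite (le_trans (dT _))// -mulrA ler_wpM2l ?invr_ge0//.
    by rewrite ler_pdivrMl.
  have VUT' : V * U * T' = 1 by apply: fredholm0_right => //; rewrite mulrA.
  exfalso; have /bopP/(_ x) := VUT'.
  rewrite -[LHS]/(V (U (T' x))) -[RHS]/x => xE.
  have [fV _] := LV (U (T' x)); move: fV; rewrite xE fx => /eqP.
  by rewrite oner_eq0.
apply: (@fredholm0D _ (y - T x) f).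
(* Write [z = v + a x] with [f v = 0], and let [N] be the norm of its image [T v + a y]. The
   distance [d] gives [|a| <= N / d], hence [c |v| <= N (1 + |y| / d)]; adding the two contributions
   bounds [|z|] by [K N]. *)
pose K := (1 + rnorm y / d) / c + rnorm x / d.
have K0 : 0 < K.
  rewrite ltr_pwDl ?divr_ge0 ?rnorm_ge0 ?(ltW d0)// divr_gt0//.
  by rewrite ltr_pwDl// divr_ge0 ?rnorm_ge0// ltW.
apply: (IH _ K^-1); first by rewrite invr_gt0.
- move=> z Lz; rewrite ler_pdivrMl//.
  pose a := f z; pose v := z - a *: x.
  have Lv : kers (f :: L) v.
    split; first by rewrite functionalD functionalN functionalZ fx mulr1 subrr.
    by apply: kersB => //; exact: kersZ.
  have -> : (T + rank1 (y - T x) f) z = T v + a *: y.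
    have -> : T v = T z - a *: T x by rewrite bopB bopZ.
    by rewrite -[LHS]/(T z + a *: (y - T x)) scalerBr addrA addrAC.
  set N := rnorm (T v + a *: y).
  have aN : cabs a <= N / d.
    have [->|a0] := eqVneq a 0; first by rewrite cabs0 divr_ge0 ?rnorm_ge0 ?ltW.
    rewrite ler_pdivlMr//.
    have := yd _ (kersZ (- a^-1) Lv); rewrite bopZ => yd'.
    have -> : N = cabs a * rnorm (- a^-1 *: T v - y).
      rewrite /N -rnormZ scalerBr scalerA mulrN mulfV// scaleN1r.
      by rewrite -opprD rnormN.
    by rewrite ler_wpM2l ?cabs_ge0.
  have vN : rnorm v <= N * (1 + rnorm y / d) / c.
    rewrite ler_pdivlMr// mulrC (le_trans (cT _ Lv))// mulrDr mulr1.
    have -> : T v = T v + a *: y - a *: y by rewrite addrK.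
    rewrite (le_trans (rnormB _ _))// lerD2l rnormZ mulrCA mulrC.
    by rewrite ler_wpM2l ?rnorm_ge0.
  have -> : z = v + a *: x by rewrite subrK.
  have -> : K * N = N * (1 + rnorm y / d) / c + N / d * rnorm x by rewrite /K; ring.
  rewrite (le_trans (rnormD _ _))// rnormZ lerD// ler_wpM2r ?rnorm_ge0//.
move=> d' d'0; have [T' T'F dT] := lim d' d'0.
exists (T' + rank1 (y - T x) f); first exact: fredholm0Dr.
move=> z; rewrite -[(T' + _) z]/(T' z + f z *: (y - T x)).
rewrite -[(T + _) z]/(T z + f z *: (y - T x)).
by rewrite opprD addrACA subrr addr0; exact: dT.
Qed.

(** The same correction [G] serves all operators near [T], because invertibility is stable under
    small perturbations. *)
Lemma fredholm0_open T : fredholm0 T -> exists2 d, 0 < d &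
  forall T', (forall x, rnorm (T' x - T x) <= d * rnorm x) -> fredholm0 T'.
Proof.
move=> [G Gf]; rewrite [G]mx11_scalar -raddfD /= => /op_unit_mx Tu.
have [c c0 cT] := op_unit_bounded_below Tu.
exists (c / 2) => [|T' dT]; first by rewrite divr_gt0.
exists G => //; rewrite [G]mx11_scalar -raddfD /=; apply/op_unit_mx.
have -> : T' + G 0 0 = T + G 0 0 + (T' - T).
  by rewrite [RHS]addrC addrA subrK.
by apply: (@op_unit_perturb X _ _ c (c / 2)) => //; apply/andP; split; lra.
Qed.

(** Connectedness of the real line: the set of good parameters contains 0, is open by
    [fredholm0_open] and closed by [fredholm0_closed], so it contains 1. *)
Lemma fredholm0_path (S : bop X X) :
  (forall t : R, exists2 L : seq (functional X) * R, 0 < L.2 &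
     bounded_below L.1 (bop_id X + t%:C *: S) L.2) ->
  fredholm0 (bop_id X + S).
Proof.
move=> Sb; pose B := [set t : R | fredholm0 (bop_id X + t%:C *: S)].
have [M M0 SM] := bop_bounded S.
have dist (s t : R) x : rnorm ((bop_id X + s%:C *: S) x - (bop_id X + t%:C *: S) x) <=
    `|s - t| * M * rnorm x.
  rewrite -[(bop_id X + s%:C *: S) x]/(x + s%:C *: S x).
  rewrite -[(bop_id X + t%:C *: S) x]/(x + t%:C *: S x).
  rewrite opprD addrACA subrr add0r -scalerBl -rmorphB rnormZ cabs_real.
  by rewrite -mulrA ler_wpM2l.
suff BT : B = setT.
  by have : B 1 by [rewrite BT]; rewrite /B /= scale1r.
have : connected [set: R] by apply/connected_intervalP.
apply.
- exists 0 => /=; rewrite /B /= scale0r addr0; apply: op_unit_fredholm0.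
  by exists 1; rewrite mulr1.
- exists B; last by rewrite setTI.
  rewrite openE => t Bt; have [d d0 dT] := fredholm0_open Bt.
  apply/nbhs_ballP; exists (d / M) => /=; first by rewrite divr_gt0.
  move=> s; rewrite /ball /= ltr_pdivlMr// => st; apply: dT => x.
  rewrite (le_trans (dist _ _ _))// ler_wpM2r ?rnorm_ge0//.
  by rewrite distrC ltW.
exists B; last by rewrite setTI.
move=> t clt; have [[L c] /= c0 Lc] := Sb t.
apply: (fredholm0_closed c0 Lc) => d d0.
have [|s [Bs]] := clt (ball t (d / M)).
  by apply/nbhs_ballP; exists (d / M) => //=; rewrite divr_gt0.
rewrite /ball /= ltr_pdivlMr// => st; exists (bop_id X + s%:C *: S) => // x.
rewrite (le_trans (dist _ _ _))// ler_wpM2r ?rnorm_ge0//.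
by rewrite distrC ltW.
Qed.

End Fredholm.

(* The span of the x_k has coordinates |a_k| <= 2^k |x|, because f_k kills the
   x_j with j > k; this beats the bounds on T x_k. *)
Lemma triangular_span_bound (X : normedModType R[i]) (T : bop X X)
    (x : nat -> X) (f : nat -> functional X) :
  (forall k, f k (x k) = 1) -> (forall k y, cabs (f k y) <= rnorm y) ->
  (forall k, rnorm (x k) <= 1) ->
  (forall i k, (i < k)%N -> f i (x k) = 0) ->
  (forall k, rnorm (T (x k)) <= 2^-1 ^+ k * 2^-1 ^+ k.+2) ->
  forall N (a : nat -> R[i]),
    rnorm (T (\sum_(k < N) a k *: x k)) <= 2^-1 * rnorm (\sum_(k < N) a k *: x k).
Proof.
move=> fx fb xb tri Tx N a; set y := \sum_(_ < _) _.
have half0 n : 0 <= (2^-1 : R) ^+ n by rewrite exprn_ge0// invr_ge0.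
have rnorm_sum M (F : nat -> X) : rnorm (\sum_(k < M) F k) <= \sum_(k < M) rnorm (F k).
  elim: M => [|M IH]; first by rewrite !big_ord0 rnorm0.
  by rewrite !big_ord_recr/= (le_trans (rnormD _ _))// lerD2r.
have aE j : (j < N)%N -> a j = f j (y - \sum_(k < j) a k *: x k).
  move=> jN; rewrite functionalD functionalN !functional_sum.
  under eq_bigr do rewrite functionalZ; under [X in _ - X]eq_bigr do rewrite functionalZ.
  rewrite -(subnKC jN) big_split_ord /= big_ord_recr /= fx mulr1.
  rewrite [X in _ + _ + X]big1 ?addr0 => [|k _]; last first.
    by rewrite tri ?mulr0// ltnS leq_addr.
  by apply/eqP; rewrite eq_sym subr_eq addrC; apply/eqP; congr (_ + _).
have ab j : (j < N)%N -> cabs (a j) <= 2 ^+ j * rnorm y.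
  elim/ltn_ind: j => j IH jN; rewrite [in leLHS]aE// (le_trans (fb _ _))//.
  rewrite (le_trans (rnormB _ _))//.
  (* The identity [2^j = 1 + sum_(k < j) 2^k] closes the recursive estimate of the coordinates. *)
  have -> : 2 ^+ j * rnorm y = rnorm y + \sum_(k < j) 2 ^+ k * rnorm y.
    elim: (j) => [|m IHm]; first by rewrite big_ord0 addr0 expr0 mul1r.
    by rewrite big_ord_recr /= addrA -IHm exprS; ring.
  rewrite lerD2l (le_trans (rnorm_sum _ (fun k => a k *: x k)))//.
  apply: ler_sum => k _; rewrite rnormZ (le_trans (_ : _ <= cabs (a k) * 1))//.
    by rewrite ler_wpM2l ?cabs_ge0.
  by rewrite mulr1 IH// (ltn_trans _ jN).
have -> : T y = \sum_(k < N) a k *: T (x k).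
  by rewrite /y linear_sum; apply: eq_bigr => k _; exact: bopZ.
rewrite (le_trans (rnorm_sum _ (fun k => a k *: T (x k))))//.
(* One factor [2^-k] of the bound on [T (x k)] absorbs the growth of the coordinates; the other
   leaves a geometric series with partial sums below 1/2. *)
apply: le_trans (_ : \sum_(k < N) 2^-1 ^+ k.+2 * rnorm y <= _).
  apply: ler_sum => k _; rewrite rnormZ.
  apply: le_trans (_ : (2 ^+ k * rnorm y) * (2^-1 ^+ k * 2^-1 ^+ k.+2) <= _).
    by apply: ler_pM; rewrite ?cabs_ge0 ?rnorm_ge0 ?ab.
  rewrite mulrAC mulrA -exprMn mulfV ?pnatr_eq0// expr1n mul1r mulrC.
  by rewrite lexx.
rewrite -mulr_suml ler_wpM2r ?rnorm_ge0//.
suff : \sum_(k < N) (2^-1 : R) ^+ k.+2 = 2^-1 - 2^-1 ^+ N.+1.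
  by move=> ->; rewrite gerBl.
elim: (N) => [|m IHm]; first by rewrite big_ord0 expr1 subrr.
by rewrite big_ord_recr /= IHm !exprS; field.
Qed.

Lemma has_dim_dependent (V : lmodType R[i]) (E : set V) n (x : 'I_n.+1 -> V) :
  has_dim E n -> (forall k, E (x k)) ->
  exists2 a : 'I_n.+1 -> R[i], \sum_k a k *: x k = 0 & exists k, a k <> 0.
Proof.
move=> [v [_ ->]] xE.
have /choice[c cx] k : exists c : 'I_n -> R[i], \sum_i c i *: v i = x k.
  by have [c _ cx] := xE k; exists c.
pose M := \matrix_(k, i) c k i.
have /rowV0Pn[u /sub_kermxP uM u0] : kermx M != 0.
  rewrite kermx_eq0 /row_free; apply/eqP => rM.
  by have := rank_leq_col M; rewrite rM ltnn.
exists (u 0); last first.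
  apply: contrapT => all0; move/eqP: u0; apply; apply/rowP => k.
  by rewrite mxE; apply: contrapT => uk; apply: all0; exists k.
under eq_bigr do rewrite -cx scaler_sumr.
rewrite exchange_big /=; apply: big1 => i _.
under eq_bigr do rewrite scalerA.
rewrite -scaler_suml (_ : \sum_(k < n.+1) _ = 0) ?scale0r//.
have /rowP/(_ i) := uM; rewrite !mxE => uMi; rewrite -[RHS]uMi.
by apply: eq_bigr => k _; rewrite mxE.
Qed.

(** Otherwise one chooses unit vectors [x k], each killed by the norming functionals of the earlier
    ones, on which [1 + S] is tiny. On their span [1 + S] has norm at most 1/2, so [S] is bounded
    below there, although the span is infinite-dimensional. *)
Lemma strictly_singular_bounded_below (X : banach R) (S : bop X X) :
  strictly_singular X X S ->
  exists2 L : seq (functional X) * R, 0 < L.2 &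
    bounded_below L.1 (bop_id X + S) L.2.
Proof.
move=> Sss; set T := bop_id X + S; apply: contrapT => none.
pose eps k : R := 2^-1 ^+ k * 2^-1 ^+ k.+2.
have eps0 k : 0 < eps k by rewrite mulr_gt0 ?exprn_gt0 ?invr_gt0.
have /choice[F FP] (Lk : seq (functional X) * nat) :
    exists xf : X * functional X,
    [/\ kers Lk.1 xf.1, xf.2 xf.1 = 1, forall y, cabs (xf.2 y) <= rnorm y,
        rnorm xf.1 = 1 & rnorm (T xf.1) <= eps Lk.2].
  case: Lk => L k /=.
  have [x Lx Tx] : exists2 x, kers L x & rnorm (T x) < eps k * rnorm x.
    apply: contrapT => Lk; apply: none; exists (L, eps k) => //= x Lx.
    by rewrite leNgt; apply/negP => Tx; apply: Lk; exists x.
  have x0 : x != 0.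
    by apply: contraTneq Tx => ->; rewrite rnorm0 mulr0 -leNgt rnorm_ge0.
  have nx0 := rnorm_gt0 x0.
  pose x1 := ((rnorm x)^-1)%:C *: x.
  have nx1 : rnorm x1 = 1.
    by rewrite rnormZ cabs_real ger0_norm ?invr_ge0 ?rnorm_ge0// mulVf ?gt_eqF.
  have x10 : x1 != 0.
    by apply/eqP => x10; have /eqP := nx1; rewrite x10 rnorm0 eq_sym oner_eq0.
  have [f [fx1 fb]] := hahn_banach x10.
  exists (x1, f); split=> //=; first exact: kersZ.
    by move=> y; have := fb y; rewrite nx1 mulr1.
  rewrite -[X in rnorm X]/(T x1) bopZ rnormZ cabs_real ger0_norm ?invr_ge0 ?rnorm_ge0//.
  by rewrite ler_pdivrMl// mulrC ltW.
(* [Ls k] lists the functionals chosen before stage [k]; the next vector is taken in their common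
   kernel. *)
pose Ls := fix Ls k := if k is j.+1 then (F (Ls j, j)).2 :: Ls j else [::].
pose x k := (F (Ls k, k)).1; pose f k := (F (Ls k, k)).2.
have tri i k : (i < k)%N -> f i (x k) = 0.
  have : kers (Ls k) (x k) by case: (FP (Ls k, k)).
  elim: k (x k) => //= k IH y [fy Ly]; rewrite ltnS leq_eqVlt.
  by move=> /predU1P[->//|]; exact: (IH y Ly).
have fx k : f k (x k) = 1 by case: (FP (Ls k, k)).
have fb k y : cabs (f k y) <= rnorm y by case: (FP (Ls k, k)).
have xb k : rnorm (x k) <= 1 by case: (FP (Ls k, k)) => _ _ _ ->.
have Tx k : rnorm (T (x k)) <= eps k by case: (FP (Ls k, k)).
have spanT := triangular_span_bound fx fb xb tri Tx.
pose E := [set y | exists N (a : nat -> R[i]), y = \sum_(k < N) a k *: x k].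
have widen N M (a : nat -> R[i]) : (N <= M)%N ->
    \sum_(k < N) a k *: x k = \sum_(k < M) (if (k < N)%N then a k else 0) *: x k.
  move=> NM; rewrite (big_ord_widen _ (fun k => a k *: x k) NM) big_mkcond.
  by apply: eq_bigr => k _; case: ifP => // _; rewrite scale0r.
have Esub : is_subspace E.
  split; first by exists 0, (fun=> 0); rewrite big_ord0.
  move=> c _ _ [N [a ->]] [M [b ->]]; exists (maxn N M).
  rewrite (widen _ _ a (leq_maxl N M)) (widen _ _ b (leq_maxr N M)).
  exists (fun k => c * (if (k < N)%N then a k else 0) + (if (k < M)%N then b k else 0)).
  rewrite scaler_sumr -big_split; apply: eq_bigr => k _.
  by rewrite scalerDl scalerA.
have [|n En] := Sss E Esub.
  exists (2^-1)%:C; first by rewrite ltcR invr_gt0.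
  move=> _ [N [a ->]]; set y := \sum_(_ < _) _.
  rewrite -!rnormE -rmorphM lecR; have := spanT N a; rewrite -/y /=.
  have := rnorm_triangle y (- S y); rewrite opprK rnormN.
  rewrite -[y + S y]/(T y); lra.
have [|a a0 [k]] := @has_dim_dependent _ E n (fun k : 'I_n.+1 => x k) En.
  move=> k; exists n.+1, (fun j => (j == k :> nat)%:R); rewrite (bigD1 k)//= eqxx scale1r.
  rewrite big1 ?addr0// => j; rewrite -val_eqE /= => /negbTE->.
  by rewrite scale0r.
(* Independence by triangularity: applying [f k] to the relation kills the later terms, and the
   earlier coefficients vanish by induction. *)
apply; elim/ltn_ind: {k}(nat_of_ord k) {-2}k (erefl (nat_of_ord k)) => m IH k km.
have := congr1 (f k) a0; rewrite functional_sum functional0 (bigD1 k)//=.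
rewrite big1 ?addr0 => [|j]; last rewrite -val_eqE /= => jk.
  by rewrite functionalZ fx mulr1.
rewrite functionalZ; have [jk'|kj] := ltnP j k.
  by rewrite (IH j) ?mul0r// -km.
by rewrite tri ?mulr0// ltn_neqAle kj andbT eq_sym.
Qed.

Lemma ideal_fredholm0 (X : banach R) (I : operator_ideal R) (w : X)
    (gamma : functional X) (S : bop X X) :
  gamma w = 1 -> I X X `<=` strictly_singular X X -> I X X S ->
  fredholm0 w gamma (bop_id X + S).
Proof.
move=> gw Iss IS; apply: fredholm0_path => // t.
apply/strictly_singular_bounded_below/Iss.
have [I0 IZ] := ideal_subspace I X X.
by rewrite -[_ *: _]addr0; exact: IZ.
Qed.

End Operators.

(** * The algebra I(X) + C 1 *)

Section SharpAlgebra.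
Variables (R : realType) (I : operator_ideal R) (X : banach R).
Hypothesis I_nonzero : I X X <> [set 0].
Hypothesis I_ss : I X X `<=` strictly_singular X X.

Let I0 : I X X 0. Proof. by case: (ideal_subspace I X X). Qed.

Let IZD (a : R[i]) (f g : bop X X) : I X X f -> I X X g -> I X X (a *: f + g).
Proof. by case: (ideal_subspace I X X) => _; exact. Qed.

Let ID (f g : bop X X) : I X X f -> I X X g -> I X X (f + g).
Proof. by move=> /(IZD 1); rewrite scale1r; exact. Qed.

Let IZ a (f : bop X X) : I X X f -> I X X (a *: f).
Proof. by move=> /(IZD a)/(_ I0); rewrite addr0. Qed.

Let IMr (f g : bop X X) : I X X f -> I X X (f * g).
Proof.
by move=> If; have := ideal_comp g (bop_id X) If; congr (I X X _); exact/bopP.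
Qed.

Let IMl (f g : bop X X) : I X X f -> I X X (g * f).
Proof.
by move=> If; have := ideal_comp (bop_id X) g If; congr (I X X _); exact/bopP.
Qed.

(** A nonzero [S] in the ideal has some [S z <> 0], and a functional [g] with [g (S z) = 1] factors
    the given operator through [S]. *)
Lemma rank1_ideal (y : X) (f : functional X) : I X X (rank1 y f).
Proof.
have [S IS S0] : exists2 S : bop X X, I X X S & S <> 0.
  apply: contrapT => none; apply: I_nonzero; apply/seteqP; split=> [S IS|_ ->//].
  by apply: contrapT => S0; apply: none; exists S.
have [z Sz0] : exists z, S z <> 0.
  apply: contrapT => none; apply: S0; apply/bopP => z.
  by apply: contrapT => Sz0; apply: none; exists z.
have /eqP/hahn_banach[g [gSz _]] := Sz0.
have -> : rank1 y f = rank1 y g * (S * rank1 z f).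
  by rewrite rank1Ml rank1M gSz scale1r.
exact/IMl/IMr.
Qed.

(** Otherwise the identity would be strictly singular and [X] finite-dimensional. This makes the
    scalar part of an element of [sharp I X] unique. *)
Lemma ideal_scalar z : I X X (z *: bop_id X) -> z = 0.
Proof.
move=> Iz; apply: contrapT => /eqP z0.
have : finite_dim [set: X].
  apply: (I_ss (IZ z^-1 Iz)) => //; exists 1; first exact: ltr01.
  by move=> x _; rewrite scalerA mulVf// scale1r mul1r.
by case: (X) => ? /=.
Qed.

Lemma in_sharp_ideal (a : bop X X) : I X X a -> a \in @in_sharp R I X.
Proof. by move=> Ia; apply/asboolP; exists a, 0; rewrite scale0r addr0. Qed.

Lemma scalar_coefE (a : sharp I X) z :
  I X X (sharp_val a - z *: bop_id X) -> scalar_coef a = z.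
Proof.
move=> Iz; rewrite /scalar_coef; case: xgetP => [t -> It|/(_ z)//].
apply/eqP; rewrite -subr_eq0; apply/eqP/ideal_scalar.
have := IZD (-1) It Iz; rewrite scaleN1r opprB addrA subrK.
by rewrite scalerBl.
Qed.

Lemma scalar_coefP (a : sharp I X) :
  I X X (sharp_val a - scalar_coef a *: bop_id X).
Proof.
have /asboolP[b [z [Ib aE]]] := sharpP a.
have Iz : I X X (sharp_val a - z *: bop_id X) by rewrite aE addrK.
by rewrite (scalar_coefE Iz).
Qed.

Lemma scalar_coef_zmod : zmod_morphism (@scalar_coef R I X).
Proof.
move=> a b; apply: scalar_coefE.
have := IZD (-1) (scalar_coefP b) (scalar_coefP a).
rewrite -[sharp_val (a - b)]/(sharp_val a - sharp_val b).
congr (I X X _); rewrite scaleN1r opprB scalerBl opprB addrC.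
by rewrite addrACA [RHS]addrACA; congr (_ + _); exact: addrC.
Qed.

Lemma scalar_coef_monoid : monoid_morphism (@scalar_coef R I X).
Proof.
split=> [|a b].
  by apply: scalar_coefE; rewrite scale1r subrr.
apply: scalar_coefE.
(* With scalar parts [s] and [t]: [a b - s t = (a - s) b + s (b - t)]. *)
have := ID (IMr (sharp_val b) (scalar_coefP a)) (IZ (scalar_coef a) (scalar_coefP b)).
congr (I X X _); apply/bopP => x.
set s := scalar_coef a; set t := scalar_coef b.
rewrite -[LHS]/(sharp_val a (sharp_val b x) - s *: sharp_val b x +
  s *: (sharp_val b x - t *: x)).
rewrite -[RHS]/(sharp_val a (sharp_val b x) - (s * t) *: x).
by rewrite scalerBr scalerA addrA subrK.
Qed.

Definition sharp_sigma : {rmorphism sharp I X -> R[i]} :=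
  HB.pack (@scalar_coef R I X)
    (GRing.isZmodMorphism.Build _ _ _ scalar_coef_zmod)
    (GRing.isMonoidMorphism.Build _ _ _ scalar_coef_monoid).

Definition sharp_scal (z : R[i]) : sharp I X := z *: (1 : sharp I X).

Lemma sharp_scal_zmod : zmod_morphism sharp_scal.
Proof. by move=> a b; rewrite /sharp_scal scalerBl. Qed.

Lemma sharp_scal_monoid : monoid_morphism sharp_scal.
Proof.
split=> [|a b]; first exact: scale1r.
apply: val_inj; apply/bopP => x.
by rewrite -[LHS]/((a * b) *: x) -[RHS]/(a *: (b *: x)) scalerA.
Qed.

Definition sharp_iota : {rmorphism R[i] -> sharp I X} :=
  HB.pack sharp_scal
    (GRing.isZmodMorphism.Build _ _ _ sharp_scal_zmod)
    (GRing.isMonoidMorphism.Build _ _ _ sharp_scal_monoid).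

Lemma sharp_lift m n (M : 'M[bop X X]_(m, n)) :
  (forall i j, I X X (M i j)) ->
  exists N : 'M[sharp I X]_(m, n), map_mx sharp_val N = M.
Proof.
move=> IM; exists (\matrix_(i, j) Sharp (in_sharp_ideal (IM i j))).
by apply/matrixP => i j; rewrite !mxE.
Qed.

Lemma sharp_mulmx m n p (M : 'M[sharp I X]_(m, n)) (N : 'M[sharp I X]_(n, p)) :
  map_mx sharp_val (M *m N) = map_mx sharp_val M *m map_mx sharp_val N.
Proof.
apply/matrixP => i j; rewrite !mxE.
apply: etrans (raddf_sum (\val : sharp I X -> bop X X) _ _ _) _.
by apply: eq_bigr => k _; rewrite !mxE.
Qed.

Lemma sharp_mx_inj m n : injective (fun M : 'M[sharp I X]_(m, n) => map_mx sharp_val M).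
Proof.
move=> M N /matrixP MN; apply/matrixP => i j; apply: val_inj.
by have := MN i j; rewrite !mxE.
Qed.

(** * The rank one idempotent of the algebra and the Fredholm property *)

Variables (w : X) (gamma : functional X).
Hypothesis gamma_w : gamma w = 1.

Definition sharp_corner : sharp I X := Sharp (in_sharp_ideal (rank1_ideal w gamma)).
Let e := sharp_corner.

Lemma sharp_scalC z (a : sharp I X) : sharp_iota z * a = a * sharp_iota z.
Proof. by apply: val_inj; exact: bop_scalC. Qed.

Lemma sharp_corner_idem : e * e = e.
Proof. by apply: val_inj; exact: corner_rank1_idem. Qed.

Lemma sharp_corner_neq0 : e != 0.
Proof.
by apply: contra_neq (corner_rank1_neq0 gamma_w) => /(congr1 sharp_val).
Qed.

Lemma sharp_cornerE b :
  e * b * e = sharp_iota (gamma (sharp_val b w)) * e.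
Proof.
apply: val_inj; rewrite -[LHS]/(rank1 w gamma * sharp_val b * rank1 w gamma).
by rewrite corner_rank1E.
Qed.

Lemma sharp_sigma_corner : sharp_sigma e = 0.
Proof.
by apply: scalar_coefE; rewrite scale0r subr0; exact: rank1_ideal.
Qed.

Lemma sharp_sigmaK z : sharp_sigma (sharp_iota z) = z.
Proof. by apply: scalar_coefE; rewrite -[X in X - _]/(z *: bop_id X) subrr. Qed.

Lemma sharp_corner_right b : e * b != 0 -> exists c, e * b * c * e = e.
Proof.
move=> eb0; have [z bz] : exists z, gamma (sharp_val b z) <> 0.
  apply: contrapT => none; move/eqP: eb0; apply; apply: val_inj; apply/bopP => z.
  rewrite -[LHS]/(gamma (sharp_val b z) *: w) (_ : gamma _ = 0) ?scale0r//.
  by apply: contrapT => bz; apply: none; exists z.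
exists (Sharp (in_sharp_ideal (rank1_ideal ((gamma (sharp_val b z))^-1 *: z) gamma))).
apply: val_inj.
rewrite -[LHS]/(rank1 w gamma * sharp_val b * rank1 _ gamma * rank1 w gamma).
rewrite rank1Mr rank1M -[functional_comp _ _ _]/(gamma (sharp_val b (_ *: z))).
rewrite bopZ functionalZ mulVf ?scale1r; last exact/eqP.
exact: corner_rank1_idem.
Qed.

Lemma sharp_fredholm (a : sharp I X) : sharp_sigma a = 1 ->
  exists2 G : 'M[sharp I X]_1, mx_finite e G & mx_unit (a%:M + G).
Proof.
move=> sa; pose S := sharp_val a - bop_id X.
have IS : I X X S by have := scalar_coefP a; rewrite [scalar_coef a]sa scale1r.
have [G Gf] := ideal_fredholm0 gamma_w I_ss IS.
rewrite [G]mx11_scalar -raddfD /= => /op_unit_mx[V [UV VU]].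
have aE : bop_id X + S = sharp_val a by rewrite addrC subrK.
rewrite aE in UV VU.
have [r [b [c GE]]] := Gf.
(* As [e] is idempotent, [b e c = (b e) e (e c)], and the entries of [b e] and [e c] are rank one or
   zero, hence in the ideal. *)
have [b' b'E] : exists N : 'M[sharp I X]_(1, r),
    map_mx sharp_val N = b *m (rank1 w gamma)%:M.
  apply: sharp_lift => i j; rewrite mxE; apply: big_ind => // k _.
  rewrite mxE; case: eqP => _; rewrite ?mulr1n ?rank1Ml ?mulr0n ?mulr0//.
  exact: rank1_ideal.
have [c' c'E] : exists N : 'M[sharp I X]_(r, 1),
    map_mx sharp_val N = (rank1 w gamma)%:M *m c.
  apply: sharp_lift => i j; rewrite mxE; apply: big_ind => // k _.
  rewrite mxE; case: eqP => _; rewrite ?mulr1n ?rank1Mr ?mulr0n ?mul0r//.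
  exact: rank1_ideal.
pose G' := b' *m e%:M *m c'.
have G'E : map_mx sharp_val G' = G.
  have eE : map_mx sharp_val (e%:M : 'M_r) = (rank1 w gamma)%:M.
    by apply/matrixP => i j; rewrite !mxE; case: eqP.
  rewrite !sharp_mulmx b'E c'E eE GE !mulmxA; congr (_ *m _).
  by rewrite -!mulmxA -!scalar_mxM !corner_rank1_idem.
exists G'; first by exists r, b', c'.
have IG : I X X (G 0 0).
  rewrite GE mxE; apply: big_ind => // k _; rewrite -b'E mxE; apply: IMr.
  have /matrixP/(_ 0 k) := b'E; rewrite !mxE => ->; apply: big_ind => // l _.
  rewrite mxE; case: eqP => _; rewrite ?mulr1n ?rank1Ml ?mulr0n ?mulr0//.
  exact: rank1_ideal.
(* The inverse of [1 + (S + G)] is [1 - (S + G) V], which exhibits it as an element of I(X) + C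
   1. *)
have VE : V = bop_id X + (-1) *: ((S + G 0 0) * V).
  have UE : sharp_val a + G 0 0 = 1 + (S + G 0 0) by rewrite addrA -aE.
  have VK : V + (S + G 0 0) * V = bop_id X by rewrite -{1}[V]mul1r -mulrDl -UE.
  by rewrite scaleN1r -VK addrK.
have Vs : V \in @in_sharp R I X.
  apply/asboolP; exists ((-1) *: ((S + G 0 0) * V)), 1; split.
    exact/IZ/IMr/ID.
  by rewrite scale1r addrC.
have UVE : (a%:M + G') = (a + G' 0 0)%:M by rewrite raddfD /= -mx11_scalar.
have G00 : sharp_val (G' 0 0) = G 0 0 by rewrite -G'E [RHS]mxE.
exists (Sharp Vs)%:M; rewrite UVE -!scalar_mxM; split; congr (_%:M); apply: val_inj.
  by rewrite -[LHS]/((sharp_val a + sharp_val (G' 0 0)) * V) G00; exact: UV.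
by rewrite -[LHS]/(V * (sharp_val a + sharp_val (G' 0 0))) G00; exact: VU.
Qed.

End SharpAlgebra.

(** The range is spanned by one vector [v0], and a functional equal to 1 at a nonzero coordinate of
    [v0] reads off the coefficient. Idempotency then multiplies every entry by the trace
    [\sum_j phi j (v j)], so the trace is 1, as [Q] is nonzero. *)
Lemma rank_one_mxE (R : realType) (X : banach R) n (Q : idem (bop X X) n.+1) :
  has_rank Q 1 -> exists (v : 'I_n.+1 -> X) (phi : 'I_n.+1 -> functional X),
    (forall i j, Q i j = rank1 (v i) (phi j)) /\ \sum_j phi j (v j) = 1.
Proof.
move=> [v [vfree vE]]; pose v0 : {ffun 'I_n.+1 -> X} := v 0.
have v00 : v0 <> 0.
  move=> v00; have /(vfree (fun=> 1))/(_ 0)/eqP : \sum_(i < 1) (1 : R[i]) *: v i = 0.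
    by rewrite big_ord1 -/v0 v00 scaler0.
  by rewrite oner_eq0.
have [i0 /eqP/hahn_banach[g [gv _]]] : exists i, v0 i <> 0.
  apply: contrapT => none; apply: v00; apply/ffunP => i; rewrite [RHS]ffunE.
  by apply: contrapT => vi; apply: none; exists i.
pose phi j := functional_comp g (Q i0 j).
have coord x : exists a, mx_op Q x = a *: v0.
  have : range (mx_op Q) (mx_op Q x) by exists x.
  by rewrite vE => -[a _ <-]; exists (a 0); rewrite big_ord1.
have Qv i j : Q i j = rank1 (v0 i) (phi j).
  apply/bopP => x.
  pose xj : {ffun 'I_n.+1 -> X} := [ffun k => if k == j then x else 0].
  have Qxj k : mx_op Q xj k = Q k j x.
    rewrite ffunE (bigD1 j)//= ffunE eqxx big1 ?addr0// => l lj.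
    by rewrite ffunE (negbTE lj) linear0.
  have [a Qa] := coord xj.
  have aE k : Q k j x = a *: v0 k by rewrite -Qxj Qa !ffunE.
  rewrite -[RHS]/(g (Q i0 j x) *: v0 i) !aE functionalZ gv mulr1.
  by [].
exists v0, phi; split=> //.
have [x _ vx] : range (mx_op Q) v0.
  by rewrite vE; exists (fun=> 1) => //; rewrite big_ord1 scale1r.
have QQ i j : (\sum_k phi k (v0 k)) *: Q i j = Q i j.
  have /matrixP/(_ i j) := idemE Q; rewrite mxE => QQij; rewrite -[RHS]QQij.
  rewrite scaler_suml; apply: eq_bigr => k _.
  by rewrite !Qv rank1M.
case: (eqVneq (\sum_k phi k (v0 k)) 1) => //; rewrite -subr_eq0 => s1.
exfalso; apply: v00; rewrite -vx.
apply/ffunP => i; rewrite !ffunE; apply: big1 => j _.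
have /eqP : (\sum_k phi k (v0 k) - 1) *: Q i j = 0.
  by rewrite scalerBl QQ scale1r subrr.
by rewrite scaler_eq0 (negbTE s1) /= => /eqP->.
Qed.

Theorem theorem3p7 (R : realType) (X : banach R) (I : operator_ideal R)
    (I_nonzero : nonzero_ideal I) (I_closed : closed_ideal I)
    (I_ss : forall Y Z : banach R, I Y Z `<=` strictly_singular Y Z)
    (n : nat) (Q : idem (bop X X) n.+1)
    (Q_finite_rank : forall i j, finite_rank X X (Q i j))
    (Q_rank_one : has_rank Q 1) :
  exists Q' : idem (sharp I X) n.+1,
    map_mx sharp_val Q' = Q :> 'M_n.+1 /\
    let omega := fun nu : int => K0_class Q' *~ nu in
    {morph omega : a b / a + b} /\ set_bij [set: int] (K0_ideal I X) omega.
Proof.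
have Inz : I X X <> [set 0] by exact: I_nonzero.
have Iss : I X X `<=` strictly_singular X X by exact: I_ss.
have [v [phi [QE phiv]]] := rank_one_mxE Q_rank_one.
have [i0 vi0] : exists i, v i <> 0.
  apply: contrapT => none; have /eqP := phiv.
  rewrite big1 ?(eq_sym _ 1) ?oner_eq0// => j _.
  rewrite (_ : v j = 0) ?functional0//.
  by apply: contrapT => vj; apply: none; exists j.
have /eqP/hahn_banach[gamma [gw _]] := vi0; set w := v i0 in gw.
have [Q0 Q0E] : exists N : 'M[sharp I X]_n.+1, map_mx sharp_val N = Q.
  by apply: sharp_lift => i j; rewrite QE; exact: rank1_ideal.
have Q0_idem : Q0 *m Q0 == Q0.
  by apply/eqP/sharp_mx_inj; rewrite sharp_mulmx Q0E idemE.
exists (Idem Q0_idem); split=> //=.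
pose e := sharp_corner Inz w gamma.
have e_idem : e * e = e by exact: sharp_corner_idem.
(* The column [v i (x) gamma] and the row [w (x) phi j] multiply to [Q] in one order, because
   [gamma w = 1], and to [e] in the other, because the trace is 1. *)
have -> : K0_class (Idem Q0_idem) = K0_class (corner_idem e_idem 1).
  have [r rE] : exists N : 'M[sharp I X]_(n.+1, 1),
      map_mx sharp_val N = \matrix_(i, j) rank1 (v i) gamma.
    by apply: sharp_lift => i j; rewrite mxE; exact: rank1_ideal.
  have [t tE] : exists N : 'M[sharp I X]_(1, n.+1),
      map_mx sharp_val N = \matrix_(i, j) rank1 w (phi j).
    by apply: sharp_lift => i j; rewrite mxE; exact: rank1_ideal.
  apply: eq_K0_class; exists r, t; split; apply: sharp_mx_inj.
    rewrite sharp_mulmx rE tE Q0E; apply/matrixP => i j.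
    by rewrite !mxE big_ord1 !mxE rank1M gw scale1r QE.
  rewrite sharp_mulmx rE tE; apply/matrixP => i j; rewrite !ord1 !mxE /=.
  under eq_bigr do rewrite !mxE rank1M.
  by rewrite -scaler_suml phiv scale1r.
set g := K0_class _.
split; first by move=> a b; rewrite mulrzDr.
have corner0 := sharp_corner_neq0 Inz gw.
have g_neq0 := K0_corner_neq0 (@sharp_scalC R I X) (e_idem := e_idem) corner0
  (@sharp_cornerE R I X Inz w gamma) (sharp_sigmaK Iss)
  (sharp_fredholm Inz (I_ss := Iss) gw).
split.
- move=> nu _.
  have [m [P [sP [sPE nuE]]]] := K0_corner_mulrz (sharp_iota I X) e_idem
    (sharp_sigma_corner Inz Iss w gamma) nu.
  by exists m, P, sP.
(* Injectivity amounts to [g] having infinite order. *)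
- suff mulrz_eq0 nu : g *~ nu = 0 -> nu = 0.
    move=> a b _ _ /eqP; rewrite -subr_eq0 -mulrzBr => /eqP/mulrz_eq0/eqP.
    by rewrite subr_eq0 => /eqP.
  case: nu => [[|k]|k] //; first by move/g_neq0.
  by rewrite NegzE mulrNz => /eqP; rewrite oppr_eq0 => /eqP/g_neq0.
move=> _ [m [P [sP [sPE ->]]]].
have [nu nuE] := K0_class_sub_scalar e_idem (sharp_sigmaK Iss)
  (sharp_corner_right (I_nonzero := Inz) gw) (sharp_fredholm Inz (I_ss := Iss) gw) sPE.
by exists nu.
Qed.
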